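(* Let $n,k\geq 1$ be integers and let $M^k_n\subseteq\Delta_{2^n-1}$ be the restricted Boltzmann machine model with $n$ visible and $k$ hidden nodes. If $k \leq 2^{\,n-\lceil \log_2 (n+1)\rceil}$ or if $k \geq 2^{\,n-\lfloor \log_2 (n+1)\rfloor}$, then $M^k_n$ is a semialgebraic set of dimension $\min\{nk+n+k,\,2^n-1\}$.
   Context: For parameters $W\in\mathbb{R}^{k\times n}$, $b\in\mathbb{R}^n$, $c\in\mathbb{R}^k$ and states $v\in\{0,1\}^n$, $h\in\{0,1\}^k$, put $\psi(v,h)=\exp(h^{\top}Wv+b^{\top}v+c^{\top}h)$ and $p(v)=\frac{1}{Z}\sum_{h\in\{0,1\}^k}\psi(v,h)$, where $Z=\sum_{v,h}\psi(v,h)$. The RBM model $M^k_n$ is the set of all vectors $(p(v))_{v\in\{0,1\}^n}$ in the open probability simplex $\Delta_{2^n-1}\subset\mathbb{R}^{2^n}$ obtained as $(W,b,c)$ ranges over $\mathbb{R}^{k\times n}\times\mathbb{R}^n\times\mathbb{R}^k$. This is the image of a polynomial map after the substitution $\gamma_i=e^{c_i}$, $\omega_{ij}=e^{W_{ij}}$, $\beta_j=e^{b_j}$, hence a semialgebraic set; its dimension is its dimension as a semialgebraic set. *)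

(* Defs.v *)
From HB Require Import structures.
From mathcomp Require Import all_boot all_order all_algebra.
From mathcomp Require Import reals sequences exp.
From mathcomp Require Import mpoly.
Set Implicit Arguments. Unset Strict Implicit. Unset Printing Implicit Defensive.
Import Order.TTheory GRing.Theory Num.Theory.
Local Open Scope ring_scope.

(* Binary encoding: state index i : 'I_(2^m) encodes the 0/1 vector
   (bit i 0, ..., bit i (m-1)), a bijection {0..2^m-1} <-> {0,1}^m. *)
Definition bit (i j : nat) : bool := odd (i %/ 2 ^ j).

Section RBM.
Variable R : realType.
Variables n k : nat.

Definition bitR (i j : nat) : R := (bit i j)%:R.

Definition rbm_psi (W : 'I_k -> 'I_n -> R) (b : 'I_n -> R) (c : 'I_k -> R)
  (v : 'I_(2 ^ n)) (h : 'I_(2 ^ k)) : R :=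
  expR (\sum_(i < k) \sum_(j < n) bitR h i * W i j * bitR v j
        + \sum_(j < n) b j * bitR v j
        + \sum_(i < k) c i * bitR h i).

Definition rbm_Z W b c : R := \sum_(v < 2 ^ n) \sum_(h < 2 ^ k) rbm_psi W b c v h.

Definition rbm_p W b c (v : 'I_(2 ^ n)) : R :=
  (\sum_(h < 2 ^ k) rbm_psi W b c v h) / rbm_Z W b c.

Definition RBM_model : ('I_(2 ^ n) -> R) -> Prop :=
  fun x => exists W b c, forall v, x v = rbm_p W b c v.
End RBM.

Section SemiAlg.
Variable R : realType.
Variable N : nat.
Notation poly := {mpoly R[N]}.
Notation ev p x := (p.@[x]).

Definition semialgebraic (S : ('I_N -> R) -> Prop) : Prop :=
  exists L : seq (poly * seq poly),
    forall x, S x <-> has (fun pq => (ev pq.1 x == 0) && all (fun q => 0 < ev q x) pq.2) L.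

Definition prime_ideal (P : poly -> Prop) : Prop :=
  [/\ P 0, ~ P 1,
      (forall p q, P p -> P q -> P (p + q)),
      (forall p q, P q -> P (p * q)) &
      (forall p q, P (p * q) -> P p \/ P q)].

Definition vanishing_ideal (S : ('I_N -> R) -> Prop) (p : poly) : Prop :=
  forall x, S x -> ev p x = 0.

(* A strictly increasing chain P_0 < P_1 < ... < P_d of prime ideals containing
   I(S), i.e. a chain of primes of length d in R[X]/I(S). *)
Definition prime_chain_over (S : ('I_N -> R) -> Prop) (d : nat) : Prop :=
  exists P : nat -> poly -> Prop,
    [/\ (forall i, (i <= d)%N -> prime_ideal (P i)),
        (forall i p, (i <= d)%N -> vanishing_ideal S p -> P i p),
        (forall i p, (i < d)%N -> P i p -> P i.+1 p) &
        (forall i, (i < d)%N -> exists p, P i.+1 p /\ ~ P i p)].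

(* Dimension of a semialgebraic set S (Bochnak-Coste-Roy, Def. 2.8.1):
   the Krull dimension of the ring R[X]/I(S) of polynomial functions on S. *)
Definition semialg_dim (S : ('I_N -> R) -> Prop) (d : nat) : Prop :=
  prime_chain_over S d /\ ~ prime_chain_over S d.+1.
End SemiAlg.

(* Main.v *)
(* The model is the image of a map that is rational in the exponentials of the
   n k + n + k parameters and lies on the hyperplane of total mass 1; it is
   semialgebraic by quantifier elimination.

   Upper bound.  In a chain P_0 < ... < P_J of primes, elements x_i of P_{i+1}
   outside P_i satisfy no polynomial relation modulo P_0, whereas D + 1 rational
   functions of D parameters always do, by counting monomials.

   Lower bound.  The unnormalised probability of v is
   exp (b.v) prod_i (1 + exp (c_i + W_i.v)); far out along a generic ray it is
   equivalent to the single exponential in which hidden unit i is active exactly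
   on the half-space slice h_i v = [c_i + W_i.v > 0] of the cube.  If d + 1 rows
   of the matrix with rows (1, v) (x) (1, h v) are independent, there is a nested
   sequence of families of distributions with 0, 1, ..., d parameters whose
   vanishing ideals form a strict chain of primes: the J-th family carries J
   ratios of coordinates that are algebraically independent, because distinct
   monomials in them have distinct growth rates.

   Slicings.  Disjoint Hamming balls, given by a shortened Hamming code, make the
   columns of that matrix independent provided no affine function vanishes on the
   rest of the cube; a covering by balls makes its rows independent. *)
Require Import Defs.
From HB Require Import structures.
From mathcomp Require Import all_boot all_order all_algebra.
From mathcomp Require Import reals sequences exp.
From mathcomp Require Import mpoly.
From mathcomp Require ordered_qelim qe_rcf.
From mathcomp Require Import ring lra zify.
Set Implicit Arguments. Unset Strict Implicit. Unset Printing Implicit Defensive.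
Import Order.TTheory GRing.Theory Num.Theory.
Local Open Scope ring_scope.

(** * Prime chains and algebraic independence *)

(** The matrix of [a] has more rows than columns, so its left kernel contains a nonzero row. *)
Lemma underdetermined_system (F : fieldType) (T U : finType) (a : T -> U -> F) :
  (#|U| < #|T|)%N ->
  exists2 q : T -> F, (exists t, q t != 0) &
    forall u, \sum_t q t * a t u = 0.
Proof.
move=> ltUT.
pose A := \matrix_(i < #|T|, j < #|U|) a (enum_val i) (enum_val j).
have /matrix0Pn[i [j kerN0]] : kermx A != 0.
  rewrite -mxrank_eq0 mxrank_ker subn_eq0 -ltnNge.
  exact: leq_ltn_trans (rank_leq_col A) ltUT.
exists (fun t => kermx A i (enum_rank t)).
  by exists (enum_val j); rewrite enum_valK.
move=> u; have : (kermx A *m A) i (enum_rank u) = 0 by rewrite mulmx_ker mxE.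
rewrite mxE => ker0; rewrite -[RHS]ker0 [LHS](reindex (@enum_val T T)) /=; last first.
  by apply: onW_bij; apply: enum_val_bij.
by apply: eq_bigr => l _; rewrite [A _ _]mxE enum_valK enum_rankK.
Qed.

(** * Rational functions of finitely many parameters *)

Section RationalFunctions.
Variables (R : fieldType) (X : Type) (D : nat) (t : X -> 'I_D -> R).

(** One fraction serves for all parameter values, with a denominator vanishing at none of them, so
    that denominators can be cleared globally. *)
Definition ratfun (g : X -> R) := exists P Q : {mpoly R[D]},
  forall x, Q.@[t x] != 0 /\ g x = P.@[t x] / Q.@[t x].

Lemma eq_ratfun g g' : g =1 g' -> ratfun g -> ratfun g'.
Proof. by move=> eg [P [Q h]]; exists P, Q => x; rewrite -eg. Qed.

Lemma ratfun_const c : ratfun (fun=> c).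
Proof.
by exists c%:MP, 1 => x; rewrite meval1 mevalC invr1 mulr1 oner_eq0.
Qed.

Lemma ratfun_coord i : ratfun (fun x => t x i).
Proof.
by exists 'X_i, 1 => x; rewrite meval1 mevalXU invr1 mulr1 oner_eq0.
Qed.

Lemma ratfunM g g' : ratfun g -> ratfun g' -> ratfun (fun x => g x * g' x).
Proof.
move=> [P [Q h]] [P' [Q' h']]; exists (P * P'), (Q * Q') => x.
have [[Q0 ->] [Q'0 ->]] := (h x, h' x).
by rewrite !mevalM mulf_neq0 //; split=> //; rewrite mulf_div.
Qed.

Lemma ratfunD g g' : ratfun g -> ratfun g' -> ratfun (fun x => g x + g' x).
Proof.
move=> [P [Q h]] [P' [Q' h']]; exists (P * Q' + P' * Q), (Q * Q') => x.
have [[Q0 ->] [Q'0 ->]] := (h x, h' x).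
by rewrite mevalD !mevalM mulf_neq0 //; split=> //; rewrite addf_div.
Qed.

Lemma ratfunV g : (forall x, g x != 0) -> ratfun g -> ratfun (fun x => (g x)^-1).
Proof.
move=> g0 [P [Q h]]; exists Q, P => x; have := g0 x; have [Q0 ->] := h x.
by rewrite mulf_eq0 invr_eq0 negb_or => /andP[? _]; split=> //; rewrite invf_div.
Qed.

Lemma ratfunX g m : ratfun g -> ratfun (fun x => g x ^+ m).
Proof.
move=> hg; elim: m => [|m IHm].
  by apply: (@eq_ratfun (fun=> 1)) (ratfun_const 1) => x; rewrite expr0.
by apply: eq_ratfun (ratfunM hg IHm) => x; rewrite exprS.
Qed.

Lemma ratfun_sum I (r : seq I) (p : pred I) (g : I -> X -> R) :
  (forall i, ratfun (g i)) -> ratfun (fun x => \sum_(i <- r | p i) g i x).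
Proof.
move=> hg; elim: r => [|i r IHr].
  by apply: eq_ratfun (ratfun_const 0) => x; rewrite big_nil.
have [pi|pi] := boolP (p i).
  by apply: eq_ratfun (ratfunD (hg i) IHr) => x; rewrite big_cons pi.
by apply: eq_ratfun IHr => x; rewrite big_cons (negbTE pi).
Qed.

Lemma ratfun_prod I (r : seq I) (p : pred I) (g : I -> X -> R) :
  (forall i, ratfun (g i)) -> ratfun (fun x => \prod_(i <- r | p i) g i x).
Proof.
move=> hg; elim: r => [|i r IHr].
  by apply: eq_ratfun (ratfun_const 1) => x; rewrite big_nil.
have [pi|pi] := boolP (p i).
  by apply: eq_ratfun (ratfunM (hg i) IHr) => x; rewrite big_cons pi.
by apply: eq_ratfun IHr => x; rewrite big_cons (negbTE pi).
Qed.

Lemma ratfun_meval N (phi : X -> 'I_N -> R) (p : {mpoly R[N]}) :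
  (forall v, ratfun (fun x => phi x v)) -> ratfun (fun x => p.@[phi x]).
Proof.
move=> hphi.
suff h : ratfun (fun x => \sum_(m <- msupp p) p@_m * \prod_i phi x i ^+ m i).
  by apply: eq_ratfun h => x; rewrite mevalE.
apply: ratfun_sum => m; apply: ratfunM; first exact: ratfun_const.
by apply: ratfun_prod => i; apply: ratfunX.
Qed.

Lemma msizeM_leq_pred (p q : {mpoly R[D]}) :
  (msize (p * q) <= (msize p + msize q).-1)%N.
Proof.
have [->|p0] := eqVneq p 0; first by rewrite mul0r msize0.
have [->|q0] := eqVneq q 0; first by rewrite mulr0 msize0.
by rewrite msizeM.
Qed.

Lemma msize_exp (p : {mpoly R[D]}) m : (msize (p ^+ m) <= (m * msize p).+1)%N.
Proof.
elim: m => [|m IHm]; first by rewrite expr0 msize1.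
rewrite exprS; apply: leq_trans (msizeM_leq_pred _ _) _.
by rewrite mulSn; move: (m * _)%N IHm => c; lia.
Qed.

Lemma msize_prod_ord J (p : 'I_J -> {mpoly R[D]}) (s : 'I_J -> nat) :
  (forall i, (msize (p i) <= (s i).+1)%N) ->
  (msize (\prod_i p i) <= (\sum_i s i).+1)%N.
Proof.
move=> hp; apply: (big_ind2 (fun a b => (msize a <= b.+1)%N)) => //.
  by rewrite msize1.
move=> a b a' b' h h'; apply: leq_trans (msizeM_leq_pred _ _) _; lia.
Qed.

(* Clearing denominators, the M^J products of powers become polynomials of
   degree O(M) in D < J variables, hence are linearly dependent for large M. *)
Lemma ratfun_alg_dep J (g : 'I_J -> X -> R) :
  (D < J)%N -> (forall i, ratfun (g i)) ->
  exists M (q : {ffun 'I_J -> 'I_M} -> R), (exists m, q m != 0) /\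
    forall x, \sum_m q m * \prod_i g i x ^+ m i = 0.
Proof.
move=> ltDJ /fin_all_exists[P] /fin_all_exists[Q hPQ].
(* The box [U] of candidate exponents has [(M * c + 1) ^ D <= M ^ D * (c + 1) ^ D] elements. This is
   less than [M ^ (D + 1)] because [(c + 1) ^ D < M]. *)
pose c := \sum_i (msize (P i) + msize (Q i)).
pose M := ((c.+1) ^ D).+1.
pose G (m : {ffun 'I_J -> 'I_M}) := \prod_i (P i ^+ m i * Q i ^+ (M - m i)).
have sizeG m : (msize (G m) <= (M * c).+1)%N.
  rewrite /c big_distrr /=; apply: msize_prod_ord => i.
  apply: leq_trans (msizeM_leq_pred _ _) _.
  have := msize_exp (P i) (m i); have := msize_exp (Q i) (M - m i).
  have := ltn_ord (m i); nia.
pose U := {ffun 'I_D -> 'I_(M * c).+1}.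
have ltUT : (#|{: U}| < #|{: {ffun 'I_J -> 'I_M}}|)%N.
  rewrite !card_ffun !card_ord; apply: (@leq_trans (M ^ D.+1)%N); last first.
    by rewrite leq_exp2l // ltnS expn_gt0.
  apply: (@leq_ltn_trans ((M * c.+1) ^ D)%N).
    have [->|D0] := posnP D; first by rewrite !expn0.
    by rewrite leq_exp2r // /M; nia.
  by rewrite expnMn expnSr ltn_pmul2l ?expn_gt0.
have [q [m0 qm0] hq] :=
  underdetermined_system (fun m (u : U) => (G m)@_[multinom (u i : nat) | i < D]) ltUT.
exists M, q; split; first by exists m0.
have sum0 : \sum_m q m *: G m = 0.
  apply/mpolyP => u; rewrite mcoeff0 raddf_sum /=.
  under eq_bigr do rewrite mcoeffZ.
  have [small|big] := leqP (mdeg u) (M * c).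
    have ub i : (u i < (M * c).+1)%N.
      by rewrite ltnS (leq_trans _ small) // mdegE (bigD1 i) //= leq_addr.
    rewrite -[RHS](hq [ffun i => Ordinal (ub i)]); apply: eq_bigr => m _.
    by congr (_ * _@_ _); apply/mnmP => i; rewrite mnmE ffunE.
  apply: big1 => m _; rewrite [(G m)@_u]memN_msupp_eq0 ?mulr0 //.
  by apply: msize_mdeg_ge; apply: leq_trans (sizeG m) _.
move=> x; have := congr1 (meval (t x)) sum0.
rewrite meval0 raddf_sum /=.
have Q0 : \prod_i (Q i).@[t x] ^+ M != 0.
  by apply/prodf_neq0 => i _; rewrite expf_neq0 //; have [] := hPQ i x.
move=> h; apply: (mulfI Q0); rewrite mulr0 -[RHS]h big_distrr /=.
apply: eq_bigr => m _; rewrite mevalZ mulrCA; congr (_ * _).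
rewrite /G rmorph_prod -big_split /=; apply: eq_bigr => i _.
have [Qi0 ->] := hPQ i x; rewrite mevalM !rmorphXn /= expr_div_n.
have -> : (Q i).@[t x] ^+ M = (Q i).@[t x] ^+ m i * (Q i).@[t x] ^+ (M - m i).
  by rewrite -exprD subnKC // ltnW.
have := expf_neq0 (m i) Qi0.
by set a := _ ^+ _; set b := _ ^+ _; set d := _ ^+ _; move=> a0; field.
Qed.

End RationalFunctions.

(** * Length of chains of prime ideals *)

Section PrimeChains.
Variables (R : realType) (N : nat).
Implicit Types (S : ('I_N -> R) -> Prop) (p : {mpoly R[N]}).

Lemma prime_ideal_sum (P : {mpoly R[N]} -> Prop) I (r : seq I) (A : pred I) F :
  prime_ideal P -> (forall i, A i -> P (F i)) -> P (\sum_(i <- r | A i) F i).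
Proof. by case=> P0 _ PD _ _ hF; apply: big_ind. Qed.

Lemma prime_ideal_exp (P : {mpoly R[N]} -> Prop) x m :
  prime_ideal P -> P (x ^+ m) -> P x.
Proof.
case=> _ P1 _ _ PM; elim: m => [|m IHm]; first by rewrite expr0 => /P1.
by rewrite exprS => /PM[].
Qed.

(* Divide by the lowest power of x_0 in the relation; what is left lies in P_0,
   and modulo x_0, i.e. in P_1, it is a relation between the other x_i. *)
Lemma chain_alg_indep J (P : nat -> {mpoly R[N]} -> Prop) (x : nat -> {mpoly R[N]}) :
  (forall i, (i <= J)%N -> prime_ideal (P i)) ->
  (forall i p, (i < J)%N -> P i p -> P i.+1 p) ->
  (forall i, (i < J)%N -> P i.+1 (x i) /\ ~ P i (x i)) ->
  forall (T : finType) (A : pred T) (e : T -> nat -> nat) (q : T -> R),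
    {in A &, forall t u, (forall i, (i < J)%N -> e t i = e u i) -> t = u} ->
    P 0%N (\sum_(t | A t) q t *: \prod_(i < J) x i ^+ e t i) ->
    forall t, A t -> q t = 0.
Proof.
elim: J P x => [|J IHJ] P x primeP subP ltP T A e q injA.
  (* [injA] now leaves a single index, so the relation is a nonzero constant in a prime ideal. *)
  move=> P0 t At; apply/eqP; apply/negPn/negP => qt0.
  have [_ P1 _ PM _] := primeP 0%N isT; apply: P1.
  rewrite (bigD1 t) //= big_ord0 big1 ?addr0 in P0; last first.
    by move=> u /andP[Au /eqP]; case; apply: injA.
  have := PM (q t)^-1%:MP _ P0.
  by rewrite mul_mpolyC scalerA mulVf // scale1r.
move=> P0 t0 At0; apply/eqP; apply/negPn/negP => qt0.
pose B := [pred t | A t && (q t != 0)].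
have Bt0 : B t0 by rewrite inE At0.
pose t1 := [arg min_(t < t0 | B t) e t 0%N].
have [Bt1 mint1] : B t1 /\ forall t, B t -> (e t1 0 <= e t 0)%N.
  by rewrite /t1; case: arg_minnP.
pose a := e t1 0%N; pose B' := [pred t | B t && (e t 0%N == a)].
pose mon t := \prod_(i < J) x i.+1 ^+ e t i.+1.
have prime0 := primeP 0%N isT; have prime1 := primeP 1%N isT.
have [_ _ P0D P0M P0I] := prime0; have [_ _ P1D P1M P1I] := prime1.
have [x01 x00] := ltP 0%N isT.
have PB : P 0%N (\sum_(t | B t) q t *: (x 0%N ^+ (e t 0%N - a) * mon t)).
  suff /P0I[/(prime_ideal_exp prime0)//|//] : P 0%N (x 0%N ^+ a *
     \sum_(t | B t) q t *: (x 0%N ^+ (e t 0%N - a) * mon t)).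
  rewrite (_ : _ * _ = \sum_(t | A t) q t *: \prod_(i < J.+1) x i ^+ e t i) //.
  rewrite big_distrr [RHS](bigID (fun t => q t != 0)) /=.
  rewrite [X in _ = _ + X]big1 ?addr0; last first.
    by move=> t /andP[_ /negPn/eqP ->]; rewrite scale0r.
  apply: eq_bigr => t Bt; rewrite -scalerAr big_ord_recl mulrA -exprD subnKC //.
  exact: mint1.
have P1B' : P 1%N (\sum_(t | B' t) q t *: mon t).
  have := subP 0%N _ isT PB; rewrite (bigID (fun t => e t 0%N == a)) /=.
  set s1 := \sum_(_ | _) _; set s2 := \sum_(_ | _) _ => P1s.
  rewrite (_ : \sum_(_ | _) _ = s1); last first.
    by apply: eq_bigr => t /andP[_ /eqP ->]; rewrite subnn expr0 mul1r.
  (* The remaining terms keep a factor [x 0], which lies in [P 1]. *)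
  have P1s2 : P 1%N s2.
    apply: prime_ideal_sum => // t /andP[Bt ne].
    have : (0 < e t 0%N - a)%N by rewrite subn_gt0 ltn_neqAle eq_sym ne mint1.
    case: (_ - _)%N => // b _; rewrite exprS -mulrA mulrC scalerAl.
    exact: P1M.
  rewrite -[s1](addrK s2); apply: P1D => //.
  by rewrite -mulN1r; apply: P1M.
have : q t1 = 0; last by move=> h; move: Bt1; rewrite inE h eqxx andbF.
apply: (IHJ (fun i => P i.+1) (fun i => x i.+1) _ _ _ T B' (fun t i => e t i.+1)).
- by move=> i lei; apply: primeP.
- by move=> i p lti; apply: subP.
- by move=> i lti; apply: ltP.
- move=> t u /andP[/andP[At _] /eqP ta] /andP[/andP[Au _] /eqP ua] eq.
  by apply: injA => // -[|i] // lti; rewrite ?ta ?ua // eq.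
- exact: P1B'.
by rewrite inE Bt1 eqxx.
Qed.

(** Along the parametrisation, [D + 1] polynomials become rational functions of [D] parameters.
    Their relation vanishes on [S], hence lies in [P 0], against [chain_alg_indep]. *)
Lemma chain_length_bound S (X : Type) D (t : X -> 'I_D -> R) (phi : X -> 'I_N -> R) :
  (forall v, ratfun t (fun x => phi x v)) ->
  (forall y, S y -> exists x, y =1 phi x) ->
  ~ prime_chain_over S D.+1.
Proof.
move=> hphi hS [P [primeP PS subP ltP]].
have [f hf] : exists f : 'I_D.+1 -> {mpoly R[N]},
    forall i : 'I_D.+1, P i.+1 (f i) /\ ~ P i (f i).
  apply: (fin_all_exists (P := fun (i : 'I_D.+1) p => P i.+1 p /\ ~ P i p)) => i.
  exact: ltP.
have [M [q [[m0 qm0] rel]]] :=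
  ratfun_alg_dep (ltnSn D) (fun i => ratfun_meval (f i) hphi).
have I0 : P 0%N (\sum_m q m *: \prod_(i < D.+1) f (inord i) ^+ m (inord i)).
  apply: PS => // y /hS[x yx]; rewrite raddf_sum -[RHS](rel x) /=.
  apply: eq_bigr => m _; rewrite mevalZ rmorph_prod /=; congr (_ * _).
  by apply: eq_bigr => i _; rewrite rmorphXn /= inord_val (meval_eq _ yx).
pose x i := f (inord i); pose e (m : {ffun 'I_D.+1 -> 'I_M}) i : nat := m (inord i).
have ltx i : (i < D.+1)%N -> P i.+1 (x i) /\ ~ P i (x i).
  by move=> ltiD; have := hf (inord i); rewrite inordK.
have inje : {in predT &, forall m u, (forall i, (i < D.+1)%N -> e m i = e u i) -> m = u}.
  move=> m u _ _ eqmu; apply/ffunP => i; apply/val_inj.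
  by have := eqmu i (ltn_ord i); rewrite /e inord_val.
move/eqP: qm0; apply.
exact: (chain_alg_indep primeP subP ltx inje I0).
Qed.

End PrimeChains.

(** The lowest digit is the remainder modulo [B]; cancel it, divide by [B] and recurse. *)
Lemma base_digits_inj B J (m m' : nat -> nat) :
  (forall a, (a < J)%N -> (m a < B)%N) -> (forall a, (a < J)%N -> (m' a < B)%N) ->
  (\sum_(a < J) m a * B ^ a = \sum_(a < J) m' a * B ^ a)%N ->
  forall a, (a < J)%N -> m a = m' a.
Proof.
elim: J m m' => // J IHJ m m' ltm ltm'.
have shift (f : nat -> nat) :
    (\sum_(a < J.+1) f a * B ^ a = f 0%N + (\sum_(a < J) f a.+1 * B ^ a) * B)%N.
  rewrite big_ord_recl expn0 muln1 big_distrl /=; congr addn.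
  by apply: eq_bigr => a _; rewrite /bump /= add1n expnSr mulnA.
rewrite !shift => eqS; have eq0 : m 0%N = m' 0%N.
  have := congr1 (modn^~ B) eqS; rewrite !(addnC (_ 0%N)) !modnMDl !modn_small //.
    exact: ltm'.
  exact: ltm.
have B0 : (0 < B)%N by apply: leq_trans (ltm 0%N isT).
move: eqS; rewrite eq0 => /addnI/eqP; rewrite eqn_pmul2r // => /eqP eqS.
by case=> [|a] // lta; apply: (IHJ (m \o S) (m' \o S)) => // b ltb;
  [apply: ltm|apply: ltm'].
Qed.

(* Kronecker substitution t_a = y ^ (B ^ a) reduces to one variable. *)
Lemma mpoly_pos_eq0 (R : realFieldType) D (P : {mpoly R[D]}) :
  (forall t : 'I_D -> R, (forall a, 0 < t a) -> P.@[t] = 0) -> P = 0.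
Proof.
move=> P0; apply/eqP/negPn/negP => /eqP PN0.
(* Every exponent in the support is below [B], so [key] packs an exponent vector into one number
   without collisions. *)
pose B := (msize P).+1.
pose key (m : 'X_{1..D}) := (\sum_(a < D) m a * B ^ a)%N.
have key_inj : {in msupp P &, injective key}.
  move=> m m' mP mP' eqk; apply/mnmP => a.
  pose ext (u : 'X_{1..D}) i := oapp (fun j : 'I_D => u j) 0%N (insub i).
  have extE u (b : 'I_D) : ext u b = u b by rewrite /ext valK.
  rewrite -!extE; apply: (@base_digits_inj B D) => //.
  - move=> b ltb; rewrite -[b]/(val (Ordinal ltb)) extE ltnS.
    apply: leq_trans (ltnW (msize_mdeg_lt mP)).
    by rewrite mdegE (bigD1 (Ordinal ltb)) //= leq_addr.
  - move=> b ltb; rewrite -[b]/(val (Ordinal ltb)) extE ltnS.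
    apply: leq_trans (ltnW (msize_mdeg_lt mP')).
    by rewrite mdegE (bigD1 (Ordinal ltb)) //= leq_addr.
  by under eq_bigr do rewrite extE; under [RHS]eq_bigr do rewrite extE.
pose p : {poly R} := \sum_(m <- msupp P) P@_m *: 'X^(key m).
have p0 : p = 0.
  apply/eqP/negPn/negP => pN0.
  (* The integers from 1 to [size p] are roots of [p], more than its degree allows. *)
  pose rs := [seq (i.+1)%:R : R | i <- iota 0 (size p)].
  have := @max_poly_roots _ p rs pN0; rewrite size_map size_iota ltnn => h.
  suff : false by []; apply: h.
    apply/allP => _ /mapP[i _ ->]; rewrite /root /p horner_sum.
    apply/eqP; rewrite -[RHS](P0 (fun a => i.+1%:R ^+ (B ^ a))); last first.
      by move=> a; rewrite exprn_gt0.
    rewrite mevalE; apply: eq_bigr => m _.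
    rewrite hornerZ hornerXn /key -prodrXr; congr (_ * _).
    by apply: eq_bigr => a _; rewrite -exprM mulnC.
  rewrite map_inj_uniq ?iota_uniq // => i j /eqP.
  by rewrite eqr_nat => /eqP[].
have [m mP] : exists m, m \in msupp P.
  by case E: (msupp P) => [|m r]; [move/eqP: E; rewrite msupp_eq0 => /eqP|exists m;
    rewrite mem_head].
have := congr1 (fun r : {poly R} => r`_(key m)) p0; rewrite coef0 coef_sum.
rewrite (bigD1_seq m) ?msupp_uniq //= coefZ coefXn eqxx mulr1 big_seq_cond big1 ?addr0.
  by move/eqP; apply/negP; rewrite -mcoeff_msupp.
move=> u /andP[uP neq]; rewrite coefZ coefXn.
by case: eqP => [/key_inj e|]; rewrite ?mulr0 //; rewrite -(e mP uP) eqxx in neq.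
Qed.

(** If [p * q] vanishes on the image, the product of the numerators of [p] and [q] vanishes on the
    positive orthant, hence is the zero polynomial, and one factor is zero. The point [x0] keeps [1]
    out of the ideal. *)
Lemma prime_vanishing_image (R : realType) N J (X : Type) (x0 : X) (t : X -> 'I_J -> R)
    (phi : X -> 'I_N -> R) :
  (forall v, ratfun t (fun x => phi x v)) ->
  (forall s : 'I_J -> R, (forall a, 0 < s a) -> exists x, t x =1 s) ->
  prime_ideal (vanishing_ideal (fun y => exists x, y =1 phi x)).
Proof.
move=> hphi ht; split.
- by move=> y _; rewrite meval0.
- by move=> /(_ (phi x0)); rewrite meval1 => h; have /eqP := h (ex_intro _ x0 (frefl _));
    rewrite oner_eq0.
- by move=> p q Ip Iq y Sy; rewrite mevalD Ip // Iq // addr0.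
- by move=> p q Iq y Sy; rewrite mevalM Iq // mulr0.
move=> p q Ipq.
have [[P [Q hP]] [P' [Q' hP']]] := (ratfun_meval p hphi, ratfun_meval q hphi).
have /eqP : P * P' = 0.
  apply: mpoly_pos_eq0 => s s0; have [x xs] := ht s s0.
  have := Ipq (phi x) (ex_intro _ x (frefl _)).
  rewrite mevalM -!(meval_eq _ xs) mevalM.
  have [[Q0 ->] [Q'0 ->]] := (hP x, hP' x); rewrite mulf_div => /eqP.
  by rewrite mulf_eq0 invr_eq0 [_ * _.@[_] == 0 in X in _ || X]mulf_eq0 (negbTE Q0)
    (negbTE Q'0) !orbF => /eqP.
rewrite mulf_eq0 => /orP[]/eqP P0; [left|right] => y [x yx]; rewrite (meval_eq _ yx).
  by have [_ ->] := hP x; rewrite P0 meval0 mul0r.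
by have [_ ->] := hP' x; rewrite P0 meval0 mul0r.
Qed.

(* The term of largest exponential rate dominates all the others. *)
Lemma exp_growth_alg_indep (R : realType) J M (K : R) (rho : 'I_J -> R)
    (y : R -> 'I_J -> R) (q : {ffun 'I_J -> 'I_M} -> R) :
  1 <= K ->
  (forall s i, 0 <= s -> expR (s * rho i) / K <= y s i <= K * expR (s * rho i)) ->
  injective (fun m : {ffun 'I_J -> 'I_M} => \sum_i (m i)%:R * rho i) ->
  (exists m, q m != 0) ->
  exists s, \sum_m q m * \prod_i y s i ^+ m i != 0.
Proof.
move=> K1 hy rate_inj [m0 qm0].
set rate := fun m : {ffun _} => _ in rate_inj.
have K0 : 0 < K by apply: lt_le_trans K1.
pose top := [arg max_(m > m0 | q m != 0) rate m]%O.
have [qtop maxtop] : q top != 0 /\ forall m, q m != 0 -> rate m <= rate top.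
  by rewrite /top; case: arg_maxP.
(* [L] absorbs the constants of a whole monomial, whose degree is at most [J * M]. *)
pose L := K ^+ (J * M).
have L0 : 0 < L by rewrite exprn_gt0.
have hprod s (m : {ffun 'I_J -> 'I_M}) : 0 <= s ->
    expR (s * rate m) / L <= \prod_i y s i ^+ m i <= L * expR (s * rate m).
  move=> s0; rewrite /rate /L big_distrr /= expR_sum.
  have KM (i : 'I_J) : 1 <= K ^+ m i <= K ^+ M.
    by rewrite exprn_ege1 //= ler_weXn2l // ltnW.
  have eprod c : c ^+ (J * M) = \prod_(i < J) c ^+ M :> R.
    by rewrite prodr_const card_ord mulnC exprM.
  have expE i : expR (s * ((m i)%:R * rho i)) = expR (s * rho i) ^+ m i.
    by rewrite -expRM_natl; congr expR; ring.
  rewrite eprod -prodfV -!big_split /=; apply/andP; split; apply: ler_prod => i _.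
    rewrite expE; have /andP[lo hi] := hy s i s0; have /andP[K1i KMi] := KM i.
    rewrite mulr_ge0 ?exprn_ge0 ?expR_ge0 ?invr_ge0 ?exprn_ge0 ?(ltW K0) //=.
    apply: (@le_trans _ _ ((expR (s * rho i) / K) ^+ m i)).
      rewrite expr_div_n ler_wpM2l ?exprn_ge0 ?expR_ge0 // lef_pV2 // posrE exprn_gt0 //.
    by rewrite lerXn2r // nnegrE ?divr_ge0 ?expR_ge0 ?(ltW K0) // (le_trans _ lo)
      ?divr_ge0 ?expR_ge0 ?(ltW K0).
  rewrite expE; have /andP[lo hi] := hy s i s0; have /andP[K1i KMi] := KM i.
  have y0 : 0 <= y s i by apply: le_trans lo; rewrite divr_ge0 ?expR_ge0 ?(ltW K0).
  rewrite exprn_ge0 //=; apply: (@le_trans _ _ ((K * expR (s * rho i)) ^+ m i)).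
    by rewrite lerXn2r // nnegrE (le_trans y0).
  by rewrite exprMn ler_wpM2r ?exprn_ge0 ?expR_ge0.
pose T := {ffun 'I_J -> 'I_M}.
(* [c m] is the factor by which the growth of [top] has to beat that of [m]. With this [s], the
   inequality [1 + x <= expR x] yields [c m <= expR (s * (rate top - rate m))]. *)
pose c m := `|q m| * L ^+ 2 * #|{: T}|%:R / `|q top|.
pose s := \sum_(m | (q m != 0) && (m != top)) c m / (rate top - rate m).
have c0 m : 0 <= c m by rewrite divr_ge0 ?mulr_ge0 ?exprn_ge0 ?ler0n // ltW.
have gap m : q m != 0 -> m != top -> 0 < rate top - rate m.
  move=> qm ne; rewrite subr_gt0 lt_neqAle maxtop // andbT.
  by apply: contra ne => /eqP/rate_inj ->.
have s0 : 0 <= s.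
  by apply: sumr_ge0 => m /andP[qm ne]; rewrite divr_ge0 // ltW // gap.
exists s; apply/negP => /eqP sum0.
(* [A] bounds the leading term from below. The other terms are fewer than the elements of [T] and
   each is at most [A] divided by that number, so they cannot cancel it. *)
pose A := `|q top| * (expR (s * rate top) / L).
have A0 : 0 < A by rewrite mulr_gt0 ?normr_gt0 // divr_gt0 ?expR_gt0.
have cardT : 0 < #|{: T}|%:R :> R by rewrite ltr0n; apply/card_gt0P; exists top.
have small m : m != top -> `|q m * \prod_i y s i ^+ m i| <= A / #|{: T}|%:R.
  move=> ne; have [->|qm] := eqVneq (q m) 0.
    by rewrite mul0r normr0 divr_ge0 // ltW.
  have /andP[lo hi] := hprod s m s0.
  have Y0 : 0 <= \prod_i y s i ^+ m i.
    by apply: le_trans lo; rewrite divr_ge0 ?expR_ge0 ?(ltW L0).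
  rewrite normrM (ger0_norm Y0) ler_pdivlMr //.
  apply: (@le_trans _ _ (`|q m| * (L * expR (s * rate m)) * #|{: T}|%:R)).
    by rewrite ler_wpM2r ?ler0n // ler_wpM2l.
  have le_exp : c m <= expR (s * (rate top - rate m)).
    apply: le_trans (expR_ge1Dx _); apply: (@le_trans _ _ (s * (rate top - rate m)));
      last by rewrite lerDr.
    rewrite -ler_pdivrMr ?gap // /s (bigD1 m) /=; last by rewrite qm.
    rewrite lerDl; apply: sumr_ge0 => u /andP[/andP[qu neu] _].
    by rewrite divr_ge0 // ltW // gap.
  have -> : expR (s * rate m) = expR (s * rate top) / expR (s * (rate top - rate m)).
    by rewrite -expRN -expRD; congr expR; ring.
  rewrite /A; move: le_exp; rewrite /c ler_pdivrMr ?normr_gt0 //.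
  have := expR_gt0 (s * (rate top - rate m)); have := expR_gt0 (s * rate top).
  set a := expR _; set b := expR _; set d := `|q m|; set e := `|q top|; set f := _%:R.
  move=> a0 b0 h; rewrite -subr_ge0.
  have -> : e * (a / L) - d * (L * (a / b)) * f = (a / (L * b)) *
      (b * e - d * L ^+ 2 * f).
    by field; rewrite !gt_eqF.
  by rewrite mulr_ge0 ?subr_ge0 // divr_ge0 ?(ltW a0) // mulr_ge0 ?(ltW L0) ?(ltW b0).
have big : A <= `|q top * \prod_i y s i ^+ top i|.
  have /andP[lo hi] := hprod s top s0.
  rewrite normrM ler_wpM2l // (le_trans lo) // ler_norm //.
move: sum0; rewrite (bigD1 top) //= => /eqP; rewrite addr_eq0 => /eqP eqtop.
move: big; rewrite eqtop normrN => big.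
have := le_trans big (ler_norm_sum _ _ _).
apply/negP; rewrite -ltNge; apply: (@le_lt_trans _ _ (\sum_(m : T | m != top) A / #|{:
  T}|%:R)).
  exact: ler_sum.
rewrite sumr_const -[X in X < _]mulr_natr -[X in X < _]mulrA gtr_pMr // mulrC ltr_pdivrMr
  // mul1r ltr_nat.
by rewrite [X in (_ < X)%N](cardD1 top) inE ltnS; apply/subset_leq_card/subsetP => m;
  rewrite !inE andbT.
Qed.

(** * Chains inside the model *)

Section Bits.

Definition cube n := {ffun 'I_n -> bool}.
Definition bits n (v : 'I_(2 ^ n)) : cube n := [ffun j : 'I_n => bit v j].

Lemma bitS x j : bit x j.+1 = bit x./2 j.
Proof. by rewrite /bit expnS divnMA divn2. Qed.

Lemma bit_inj n x y : (x < 2 ^ n)%N -> (y < 2 ^ n)%N ->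
  (forall j, (j < n)%N -> bit x j = bit y j) -> x = y.
Proof.
elim: n x y => [|n IHn] x y; first by rewrite !expn0 !ltnS !leqn0 => /eqP-> /eqP->.
move=> ltx lty exy; rewrite -[x]odd_double_half -[y]odd_double_half.
have := exy 0%N isT; rewrite /bit expn0 !divn1 => ->; congr (_ + _.*2)%N.
apply: IHn => [||j ltj]; first by rewrite ltn_half_double -mul2n -expnS.
  by rewrite ltn_half_double -mul2n -expnS.
by rewrite -!bitS exy.
Qed.

Lemma bits_bij n : bijective (@bits n).
Proof.
apply: inj_card_bij; last by rewrite card_ffun card_bool !card_ord.
move=> v w /ffunP evw; apply/val_inj/(bit_inj (ltn_ord v) (ltn_ord w)) => j ltj.
by have := evw (Ordinal ltj); rewrite !ffunE.
Qed.

End Bits.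

(** * The hidden units summed out *)

Section Numerator.
Variables (R : realType) (n k : nat).
Local Notation N := (2 ^ n)%N.

Definition numer W b c (v : 'I_N) : R :=
  expR (\sum_(j < n) b j * bitR R v j) *
  \prod_(i < k) (1 + expR (c i + \sum_(j < n) W i j * bitR R v j)).

(** Apart from the visible bias, the exponent is a sum over the hidden units, so by distributivity
    the sum over [h] is a product of two-term sums, one for each unit. *)
Lemma sum_rbm_psi W b c v : \sum_(h < 2 ^ k) rbm_psi W b c v h = numer W b c v.
Proof.
pose act i := expR (c i + \sum_(j < n) W i j * bitR R v j).
have -> : numer W b c v = expR (\sum_j b j * bitR R v j) *
    \prod_(i < k) \sum_(x : bool) (if x then act i else 1).
  by congr (_ * _); apply: eq_bigr => i _; rewrite big_bool addrC.
rewrite bigA_distr_bigA big_distrr /= (reindex (@bits k)) /=; last first.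
  exact/onW_bij/bits_bij.
apply: eq_bigr => h _; rewrite /rbm_psi.
rewrite [X in expR (X + _)]addrC -addrA expRD; congr (_ * _).
rewrite -big_split /= expR_sum; apply: eq_bigr => i _; rewrite ffunE /bitR.
case: (bit h i); last by rewrite mulr0 addr0 big1 ?expR0 // => j _; rewrite mul0r mul0r.
by rewrite mulr1 addrC; congr expR; congr (_ + _); apply: eq_bigr => j _; rewrite mul1r.
Qed.

Lemma numer_gt0 W b c v : 0 < numer W b c v.
Proof. by rewrite mulr_gt0 ?expR_gt0 // prodr_gt0 // => i _;
  rewrite addr_gt0 ?expR_gt0. Qed.

Lemma rbm_pE W b c v : rbm_p W b c v = numer W b c v / \sum_w numer W b c w.
Proof.
by rewrite /rbm_p /rbm_Z sum_rbm_psi; congr (_ / _); apply: eq_bigr => w _;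
  apply: sum_rbm_psi.
Qed.

Lemma sum_numer_gt0 W b c : 0 < \sum_w numer W b c w.
Proof.
have lt0N : (0 < N)%N by rewrite expn_gt0.
rewrite (bigD1 (Ordinal lt0N)) //= ltr_wpDr ?numer_gt0 // sumr_ge0 // => w _.
by rewrite ltW ?numer_gt0.
Qed.

End Numerator.

Lemma base_digits_lt B J (m : nat -> nat) :
  (forall a, (a < J)%N -> (m a < B)%N) -> (\sum_(a < J) m a * B ^ a < B ^ J)%N.
Proof.
elim: J => [|J IHJ] ltm; first by rewrite big_ord0.
rewrite big_ord_recr /= expnS.
have lt_sum := IHJ (fun a lta => ltm a (leqW lta)).
by apply: leq_trans (leq_mul (ltm J (ltnSn J)) (leqnn _)); rewrite mulSn ltn_add2r.
Qed.

(** Two remainders below [C] differ by less than [C], so they cannot make up for a nonzero multiple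
    of [C]. *)
Lemma eq_quotient (C l l' : nat) (x x' : int) :
  C%:Z * x + l%:Z = C%:Z * x' + l'%:Z -> (l < C)%N -> (l' < C)%N -> x = x'.
Proof.
move=> eqx ltl ltl'; have [ltx|ltx|//] := ltrgtP x x'.
  have : C%:Z <= C%:Z * (x' - x) by rewrite ler_peMr //; lia.
  by rewrite mulrBr; lia.
have : C%:Z <= C%:Z * (x - x') by rewrite ler_peMr //; lia.
by rewrite mulrBr; lia.
Qed.

(** * Nested families along integer directions *)

Section LowerBound.
Variables (R : realType) (n k : nat).
Variables (zW : nat -> 'I_k -> 'I_n -> int) (zb : nat -> 'I_n -> int)
          (zc : nat -> 'I_k -> int).
Local Notation N := (2 ^ n)%N.

Definition bitZ (v : 'I_N) j : int := bit v j : nat.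
Definition bias a v : int := \sum_(j < n) zb a j * bitZ v j.
Definition activ a i v : int := zc a i + \sum_(j < n) zW a i j * bitZ v j.

Implicit Types s : nat -> R.
(** The parameters of the family move along the first [J] integer directions with real coefficients
    [s]. Integrality makes every exponential a Laurent monomial in the [expR (s a)]. *)
Definition lin J s (z : nat -> int) : R := \sum_(a < J) s a * (z a)%:~R.
Definition famW J s i j := lin J s (fun a => zW a i j).
Definition famb J s j := lin J s (fun a => zb a j).
Definition famc J s i := lin J s (fun a => zc a i).
Definition fam_numer J s v : R :=
  expR (lin J s (bias^~ v)) * \prod_(i < k) (1 + expR (lin J s (fun a => activ a i v))).
Definition fam J s v : R := fam_numer J s v / \sum_w fam_numer J s w.

Lemma lin_sum J s I (r : seq I) (z : I -> nat -> int) (e : I -> int) :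
  \sum_(j <- r) lin J s (z j) * (e j)%:~R = lin J s (fun a => \sum_(j <- r) z j a * e j).
Proof.
under eq_bigr do rewrite /lin big_distrl /=.
rewrite exchange_big /lin /=; apply: eq_bigr => a _.
rewrite rmorph_sum big_distrr /=; apply: eq_bigr => j _.
by rewrite rmorphM /= mulrA.
Qed.

Lemma linD J s z z' : lin J s z + lin J s z' = lin J s (fun a => z a + z' a).
Proof. by rewrite /lin -big_split; apply: eq_bigr => a _; rewrite rmorphD /= mulrDr. Qed.

Lemma numer_fam J s v : numer (famW J s) (famb J s) (famc J s) v = fam_numer J s v.
Proof.
rewrite /numer /fam_numer; congr (expR _ * _).
  by rewrite -lin_sum.
apply: eq_bigr => i _; congr (_ + expR _).
by rewrite /activ -linD; congr (_ + _); rewrite -lin_sum.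
Qed.

Lemma rbm_p_fam J s v : rbm_p (famW J s) (famb J s) (famc J s) v = fam J s v.
Proof.
by rewrite rbm_pE /fam numer_fam; congr (_ / _); apply: eq_bigr => w _; apply: numer_fam.
Qed.

Lemma fam_numer_gt0 J s v : 0 < fam_numer J s v.
Proof. by rewrite -numer_fam numer_gt0. Qed.

Lemma sum_fam_numer_gt0 J s : 0 < \sum_v fam_numer J s v.
Proof. by under eq_bigr do rewrite -numer_fam; apply: sum_numer_gt0. Qed.

Definition fam_image J (y : 'I_N -> R) := exists s, y =1 fam J s.

Lemma fam_image_rbm J y : fam_image J y -> RBM_model k y.
Proof.
case=> s ys; exists (famW J s), (famb J s), (famc J s) => v.
by rewrite rbm_p_fam.
Qed.

Lemma fam_imageS J y : fam_image J y -> fam_image J.+1 y.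
Proof.
case=> s ys; pose s' a := if (a < J)%N then s a else 0; exists s' => v.
have linS z : lin J s z = lin J.+1 s' z.
  rewrite /lin big_ord_recr /= /s' ltnn mul0r addr0.
  by apply: eq_bigr => a _; rewrite ltn_ord.
have numS w : fam_numer J s w = fam_numer J.+1 s' w.
  by rewrite /fam_numer linS; congr (_ * _); apply: eq_bigr => i _; rewrite linS.
by rewrite ys /fam numS; congr (_ / _); apply: eq_bigr => w _; apply: numS.
Qed.

Definition expcoord J s (a : 'I_J) : R := expR (s a).

Lemma ratfun_exp_lin J z : ratfun (@expcoord J) (fun s => expR (lin J s z)).
Proof.
apply: (@eq_ratfun _ _ _ _ (fun s => \prod_(a < J) expR (s a * (z a)%:~R))).
  by move=> s; rewrite /lin expR_sum.
apply: ratfun_prod => a; case: (z a) => m.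
  apply: eq_ratfun (ratfunX m (ratfun_coord _ a)) => s.
  by rewrite /expcoord -expRM_natr -pmulrn.
apply: (@eq_ratfun _ _ _ _ (fun s => (expcoord s a ^+ m.+1)^-1)).
  by move=> s; rewrite /expcoord -expRM_natr NegzE mulrNz mulrN expRN -pmulrn.
apply: ratfunV; first by move=> s; rewrite expf_neq0 // gt_eqF ?expR_gt0.
exact/ratfunX/ratfun_coord.
Qed.

Lemma ratfun_fam_numer J v : ratfun (@expcoord J) (fun s => fam_numer J s v).
Proof.
apply: ratfunM; first exact: ratfun_exp_lin.
by apply: ratfun_prod => i; apply: ratfunD; [apply: ratfun_const|apply: ratfun_exp_lin].
Qed.

Lemma ratfun_fam J v : ratfun (@expcoord J) (fun s => fam J s v).
Proof.
apply: ratfunM; first exact: ratfun_fam_numer.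
apply: ratfunV; first by move=> s; rewrite gt_eqF ?sum_fam_numer_gt0.
by apply: ratfun_sum => w; apply: ratfun_fam_numer.
Qed.

Lemma prime_fam_image J : prime_ideal (vanishing_ideal (fam_image J)).
Proof.
apply: (prime_vanishing_image (fun=> 0) (ratfun_fam J)) => y y0.
exists (fun a => oapp (fun i => ln (y i)) 0 (insub a)) => a.
by rewrite /expcoord valK /= lnK // posrE.
Qed.

Variable h : 'I_k -> 'I_N -> bool.

(* The exponent of [exp (s a)] in the leading monomial of [fam_numer] at [v], if
   [h] tells which hidden units are active there. *)
Definition expo a v : int :=
  bias a v + \sum_(i < k) activ a i v *+ h i v.

(** The slicing [h] is cut out by direction 0. Up to the factor [q], which clears denominators,
    direction [a > 0] is dual to the vertex [vs a.+1] relative to the base vertex [vs 0]; direction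
    0 has to separate only [vs 1] from [vs 0]. *)
Variables (d q : nat) (vs : nat -> 'I_N).
Hypotheses (q_gt0 : (0 < q)%N)
  (h_sign : forall i v, if h i v then 0 < activ 0 i v else activ 0 i v < 0)
  (expo_dual : forall a i, (0 < a)%N -> (a < d)%N -> (i < d)%N ->
     expo a (vs i.+1) - expo a (vs 0%N) = (q * (i == a))%:Z)
  (expo_neq : expo 0%N (vs 1%N) <> expo 0%N (vs 0%N)).

Lemma PoszSum I (l : seq I) (P : pred I) (F : I -> nat) :
  (\sum_(i <- l | P i) F i)%N%:Z = \sum_(i <- l | P i) (F i)%:Z.
Proof. exact: (big_morph Posz PoszD (erefl _)). Qed.

(** When the signs of the activations agree with [h], each factor [1 + expR u] lies between the
    exponential of the positive part of [u] and twice that; the [k] factors give [2 ^+ k]. *)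
Lemma fam_numer_growth J (r : nat -> int) v (t : R) : 0 <= t ->
  (forall i, if h i v then 0 <= \sum_(a < J) r a * activ a i v
                      else \sum_(a < J) r a * activ a i v <= 0) ->
  expR (t * (\sum_(a < J) r a * expo a v)%:~R) <=
    fam_numer J (fun a => t * (r a)%:~R) v <=
    2 ^+ k * expR (t * (\sum_(a < J) r a * expo a v)%:~R).
Proof.
move=> t0 hs; set T := \sum_(a < J) _.
have linE z : lin J (fun a => t * (r a)%:~R) z = t * (\sum_(a < J) r a * z a)%:~R.
  rewrite rmorph_sum big_distrr /=; apply: eq_bigr => a _.
  by rewrite rmorphM /= mulrA.
pose H i : int := \sum_(a < J) r a * activ a i v.
have TE : T = \sum_(a < J) r a * bias a v + \sum_(i < k) H i *+ h i v.
  rewrite /T /expo; under eq_bigr do rewrite mulrDr [X in _ + X]big_distrr /=.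
  rewrite big_split /=; congr (_ + _); rewrite exchange_big; apply: eq_bigr => i _.
  by rewrite /H -sumrMnl; apply: eq_bigr => a _; rewrite mulrnAr.
have expT : expR (t * T%:~R) = expR (t * (\sum_(a < J) r a * bias a v)%:~R) *
    \prod_(i < k) expR (t * (H i *+ h i v)%:~R).
  rewrite TE; move: (\sum_(a < J) _) => b.
  by rewrite rmorphD /= mulrDr expRD rmorph_sum big_distrr /= expR_sum.
rewrite /fam_numer linE expT mulrCA; apply/andP; split.
  rewrite ler_wpM2l ?expR_ge0 //; apply: ler_prod => i _; rewrite expR_ge0 linE /=.
  case: (h i v); first by rewrite lerDr.
  by rewrite mulr0n mulr0 expR0 lerDl expR_ge0.
rewrite ler_wpM2l ?expR_ge0 //.
have -> : 2 ^+ k = \prod_(i < k) 2 :> R by rewrite prodr_const card_ord.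
rewrite -big_split /=; apply: ler_prod => i _; rewrite addr_ge0 ?expR_ge0 //= linE.
have := hs i; rewrite -/(H i); case: (h i v) => Hi.
  rewrite mulr1n mulr2n mulrDl mul1r lerD2r -[X in X <= _]expR0 ler_expR mulr_ge0 //.
  by rewrite ler0z.
rewrite mulr0n mulr0 expR0 mulr1 mulr2n lerD2l -[X in _ <= X]expR0 ler_expR.
by rewrite mulr_ge0_le0 // lerz0.
Qed.

(* [C z_0 + M z_1 + M^2 z_2 + ...] is so close to the direction of [z_0] that the
   leading terms do not change, yet separates the exponents below [M]. *)
Lemma fam_ratio_alg_indep J M (c : {ffun 'I_J -> 'I_M} -> R) :
  (0 < J)%N -> (J <= d)%N -> (exists m, c m != 0) ->
  exists s, \sum_m c m *
    \prod_(i < J) (fam_numer J s (vs i.+1) / fam_numer J s (vs 0%N)) ^+ m i != 0.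
Proof.
move=> J0 leJd cN0.
(* [B] bounds what the directions [a > 0] add to any activation. Activations in direction 0 are
   nonzero integers, so [C >= B] preserves their signs, while [C >= q * M ^ J] leaves room for base
   [M] digits below the multiples of [C]. *)
pose B := (\sum_(a < J) \sum_i \sum_v M ^ a * `|activ a i v|)%N.
pose C := (q * M ^ J + B)%N.
pose r (a : nat) : int := if a == 0%N then C%:Z else (M ^ a)%:Z.
have rS (z : nat -> int) :
    \sum_(a < J) r a * z a = C%:Z * z 0%N + \sum_(a < J | (0 < a)%N) (M ^ a)%:Z * z a.
  rewrite (bigD1 (Ordinal J0)) //=; congr (_ + _).
  apply: eq_big => [a|a]; first by rewrite -val_eqE lt0n.
  by rewrite -val_eqE /r => /negbTE /= ->.
have hs i v : if h i v then 0 <= \sum_(a < J) r a * activ a i v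
                      else \sum_(a < J) r a * activ a i v <= 0.
  set tail := \sum_(a < J | (0 < a)%N) (M ^ a)%:Z * activ a i v.
  have tailC : `|tail| <= C%:Z.
    apply: (@le_trans _ _ B%:Z); last by rewrite lez_nat leq_addl.
    apply: le_trans (ler_norm_sum _ _ _) _; rewrite /B PoszSum big_mkcond /=.
    apply: ler_sum => a _; rewrite (bigD1 i) //= (bigD1 v) //= -addnA PoszD.
    rewrite normrM -abszE; case: ifP => _; last by rewrite addr_ge0.
    by rewrite lerDl.
  have := h_sign i v; rewrite (rS (fun a => activ a i v)) -/tail; case: (h i v) => hv;
    move: tailC hv; rewrite ler_norml.
    nia.
  nia.
have rho i : (i < J)%N -> \sum_(a < J) r a * (expo a (vs i.+1) - expo a (vs 0%N)) =
    C%:Z * (expo 0 (vs i.+1) - expo 0 (vs 0%N)) + (q * (0 < i) * M ^ i)%:Z.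
  move=> ltiJ; rewrite (rS (fun a => expo a (vs i.+1) - expo a (vs 0%N))); congr (_ + _).
  under eq_bigr => a a0 do rewrite expo_dual ?(leq_trans _ leJd) //.
  case: i ltiJ => [|i] ltiJ.
    rewrite big1 ?muln0 // => a a0; by rewrite eq_sym (gtn_eqF a0) muln0 mulr0.
  rewrite (bigD1 (Ordinal ltiJ)) //= eqxx big1 ?addr0.
    by rewrite !muln1 -PoszM mulnC.
  by move=> a /andP[_]; rewrite -val_eqE eq_sym /= => /negbTE ->; rewrite muln0 mulr0.
pose g i := expo 0 (vs i.+1) - expo 0 (vs 0%N).
pose rate i : R := (\sum_(a < J) r a * (expo a (vs i.+1) - expo a (vs 0%N)))%:~R.
(* Division by [C] splits the total rate: the remainder is [q] times a number whose base [M] digits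
   are the [m i] with [i > 0], and the quotient then yields [m 0] because [g 0] is nonzero. *)
have rate_inj : injective (fun m : {ffun 'I_J -> 'I_M} => \sum_i (m i)%:R * rate i).
  pose digits (u : {ffun 'I_J -> 'I_M}) a : nat := oapp (fun i : 'I_J =>
    u i : nat) 0%N (insub a).
  have digitsE u (i : 'I_J) : digits u i = u i by rewrite /digits valK.
  pose low u := (\sum_(i < J) ((0 < i) * digits u i) * M ^ i)%N.
  have lt_digits u a : (a < J)%N -> ((0 < a) * digits u a < M)%N.
    move=> lta; rewrite -[a]/(val (Ordinal lta)) digitsE.
    by case: (0 < _)%N; rewrite ?mul1n // mul0n (leq_ltn_trans (leq0n _) (ltn_ord (u
      (Ordinal lta)))).
  have sumE (u : {ffun 'I_J -> 'I_M}) : \sum_i (u i)%:R * rate i =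
      (C%:Z * (\sum_(i < J) (u i)%:Z * g i) + (q * low u)%:Z)%:~R.
    rewrite [(q * low u)%N]big_distrr /= PoszSum [C%:Z * _]big_distrr /= -big_split /=.
    rewrite [RHS]rmorph_sum; apply: eq_bigr => i _; rewrite /rate rho // -/(g i).
    rewrite digitsE -[(u i)%:R]/((u i)%:Z%:~R) -rmorphM; congr (_%:~R).
    by rewrite mulrDr mulrCA -PoszM; congr (_ + Posz _); ring.
  have low_small u : (low u < M ^ J)%N by exact: (base_digits_lt (lt_digits u)).
  move=> m m'; rewrite !sumE => /eqP; rewrite eqr_int => /eqP eqmm'.
  have eqg : \sum_(i < J) (m i)%:Z * g i = \sum_(i < J) (m' i)%:Z * g i.
    have ltqC u : (q * low u < C)%N.
      by apply: leq_trans (leq_addr _ _); rewrite ltn_pmul2l.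
    exact: eq_quotient eqmm' (ltqC m) (ltqC m').
  have eql : low m = low m'.
    move: eqmm'; rewrite eqg => /addrI/eqP; rewrite eqz_nat eqn_pmul2l // => /eqP //.
  have eqd a : (0 < a)%N -> (a < J)%N -> digits m a = digits m' a.
    move=> a0 lta; have := base_digits_inj (lt_digits m) (lt_digits m') eql lta.
    by rewrite a0 !mul1n.
  have eqd0 : digits m 0%N = digits m' 0%N.
    move: eqg; rewrite (bigD1 (Ordinal J0)) //= [in RHS](bigD1 (Ordinal J0)) //=.
    rewrite (eq_bigr (fun i : 'I_J => (m' i)%:Z * g i)); last first.
      by move=> i; rewrite -val_eqE /= -lt0n -!digitsE => i0; rewrite eqd.
    move/addIr/eqP; rewrite -subr_eq0 -mulrBl mulf_eq0 [g 0%N == 0]subr_eq0.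
    have /eqP/negbTE -> := expo_neq; rewrite orbF subr_eq0 eqz_nat.
    by rewrite -!digitsE => /eqP.
  apply/ffunP => i; apply/val_inj; rewrite /= -!digitsE.
  by case: (val i) (ltn_ord i) => [|a] lta; rewrite ?eqd0 // eqd.
have K1 : 1 <= 2 ^+ k :> R by rewrite exprn_ege1 // ler1n.
pose y t (i : 'I_J) := fam_numer J (fun a => t * (r a)%:~R) (vs i.+1) /
   fam_numer J (fun a => t * (r a)%:~R) (vs 0%N).
have [t i t0|t t1] := @exp_growth_alg_indep R J M (2 ^+ k) rate y c K1 _ rate_inj cN0.
  have /andP[lo hi] := @fam_numer_growth J r (vs i.+1) t t0 (hs^~ (vs i.+1)).
  have /andP[lo0 hi0] := @fam_numer_growth J r (vs 0%N) t t0 (hs^~ (vs 0%N)).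
  have -> : expR (t * rate i) = expR (t * (\sum_(a < J) r a * expo a (vs i.+1))%:~R) /
      expR (t * (\sum_(a < J) r a * expo a (vs 0%N))%:~R).
    rewrite -expRN -expRD -mulrN -mulrDr -rmorphN -rmorphD /rate -sumrB.
    by congr (expR (_ * _%:~R)); apply: eq_bigr => a _; rewrite mulrBr.
  rewrite /y; move: lo hi lo0 hi0; rewrite /=.
  have := expR_gt0 (t * (\sum_(a < J) r a * expo a (vs 0%N))%:~R).
  have := expR_gt0 (t * (\sum_(a < J) r a * expo a (vs i.+1))%:~R).
  have := fam_numer_gt0 J (fun a => t * (r a)%:~R) (vs 0%N).
  have := fam_numer_gt0 J (fun a => t * (r a)%:~R) (vs i.+1).
  set a := expR _; set b := expR _; set e := fam_numer _ _ _; set f := fam_numer _ _ _.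
  move=> e0 f0 a0 b0 lo hi lo0 hi0; have K0 : 0 < 2 ^+ k :> R by apply: lt_le_trans K1.
  have -> : a / b / 2 ^+ k = a / (2 ^+ k * b) by rewrite invfM mulrA mulrAC.
  have Kb0 : 0 < 2 ^+ k * b by rewrite mulr_gt0.
  rewrite [2 ^+ k * (a / b)]mulrA; apply/andP; split.
    by rewrite ler_pM ?(ltW a0) ?invr_ge0 ?(ltW Kb0) // lef_pV2 ?posrE.
  by rewrite ler_pM ?(ltW e0) ?invr_ge0 ?(ltW f0) // lef_pV2 ?posrE.
by exists (fun a => t * (r a)%:~R).
Qed.

(* The relation between the ratios is homogenised by powers of the coordinate
   [vs 0], so that the normalising constant cancels. *)
Lemma fam_image_lt J : (J < d)%N ->
  exists p : {mpoly R[N]}, vanishing_ideal (fam_image J) p /\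
    ~ vanishing_ideal (fam_image J.+1) p.
Proof.
move=> ltJd.
pose y I (i : 'I_J.+1) s := fam_numer I s (vs i.+1) / fam_numer I s (vs 0%N).
have ratfun_y i : ratfun (@expcoord J) (y J i).
  apply: ratfunM; first exact: ratfun_fam_numer.
  apply: ratfunV; last exact: ratfun_fam_numer.
  by move=> s; rewrite gt_eqF ?fam_numer_gt0.
(* The [J + 1] ratios are dependent on the family with [J] parameters; the same relation fails on
   the next family. *)
have [M [c [cN0 rel]]] := ratfun_alg_dep (ltnSn J) ratfun_y.
exists (\sum_m c m *: \prod_(i < J.+1) ('X_(vs i.+1) ^+ m i * 'X_(vs 0%N) ^+ (M - m i))).
have evalE I s : (\sum_m c m *: \prod_(i < J.+1) ('X_(vs i.+1) ^+ m i *
      'X_(vs 0%N) ^+ (M - m i))).@[fam I s] =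
    (\prod_(i < J.+1) fam I s (vs 0%N) ^+ M) * \sum_m c m * \prod_i y I i s ^+ m i.
  rewrite raddf_sum big_distrr /=; apply: eq_bigr => m _.
  rewrite mevalZ mulrCA rmorph_prod -big_split /=; congr (_ * _).
  apply: eq_bigr => i _; rewrite rmorphM !rmorphXn /= !mevalXU /y /fam.
  have := fam_numer_gt0 I s (vs 0%N); have := sum_fam_numer_gt0 I s.
  set Z := \sum_w _; set a := fam_numer _ _ _; set b := fam_numer _ _ _ => Z0 a0.
  have -> : (a / Z) ^+ M = (a / Z) ^+ m i * (a / Z) ^+ (M - m i).
    by rewrite -exprD subnKC // ltnW.
  rewrite [RHS]mulrAC -[in RHS]exprMn; congr (_ ^+ _ * _).
  by field; rewrite !gt_eqF.
split=> [z [s zs]|van]; first by rewrite (meval_eq _ zs) evalE rel mulr0.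
have [s /eqP[]] := fam_ratio_alg_indep (ltn0Sn J) ltJd cN0.
have /van : fam_image J.+1 (fam J.+1 s) by exists s.
rewrite evalE => /eqP.
rewrite mulf_eq0 => /orP[|/eqP //]; apply: contraTeq => _.
apply/prodf_neq0 => i _; rewrite expf_neq0 // /fam mulf_neq0 ?invr_eq0 //.
  by rewrite gt_eqF ?fam_numer_gt0.
by rewrite gt_eqF ?sum_fam_numer_gt0.
Qed.

(** Larger families have smaller vanishing ideals, so the chain runs from [d] parameters down to
    none, where the family is a single point. *)
Lemma prime_chain_over_RBM : prime_chain_over (@RBM_model R n k) d.
Proof.
exists (fun i => vanishing_ideal (fam_image (d - i))); split.
- by move=> i _; apply: prime_fam_image.
- by move=> i p _ van y /fam_image_rbm; apply: van.
- move=> i p lti van y yJ; apply: van.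
  by rewrite -(subnSK lti); apply: fam_imageS.
move=> i lti; rewrite -[(d - i)%N](subnSK lti).
by apply: fam_image_lt; rewrite ltn_subrL (leq_ltn_trans _ lti).
Qed.

End LowerBound.

(** * Semialgebraicity and upper bounds *)

Section QuantifierElimination.
Import ordered_qelim.
Variable R : realType.
Local Notation formula := (ord.formula R).
Local Notation term := (GRing.term R).

Section Semialgebraic.
Variable N : nat.
Implicit Types (S : ('I_N -> R) -> Prop) (x : 'I_N -> R).

Definition basic_open x (pq : {mpoly R[N]} * seq {mpoly R[N]}) :=
  (pq.1.@[x] == 0) && all (fun q => 0 < q.@[x]) pq.2.

Lemma eq_semialgebraic S S' :
  (forall x, S x <-> S' x) -> semialgebraic S -> semialgebraic S'.
Proof. by move=> e [L h]; exists L => x; rewrite -e. Qed.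

Lemma semialgebraicU S S' :
  semialgebraic S -> semialgebraic S' -> semialgebraic (fun x => S x \/ S' x).
Proof.
move=> [L h] [L' h']; exists (L ++ L') => x; rewrite has_cat h h'.
by split=> [/orP|/orP].
Qed.

(** A basic piece carries a single equation, so two equations are merged into a sum of squares. *)
Lemma semialgebraicI S S' :
  semialgebraic S -> semialgebraic S' -> semialgebraic (fun x => S x /\ S' x).
Proof.
move=> [L h] [L' h'].
exists [seq (pq.1 * pq.1 + rs.1 * rs.1, pq.2 ++ rs.2) | pq <- L, rs <- L'] => x.
rewrite h h' -/(basic_open x).
have basicI (pq rs : {mpoly R[N]} * seq {mpoly R[N]}) :
    basic_open x (pq.1 * pq.1 + rs.1 * rs.1, pq.2 ++ rs.2) =
    basic_open x pq && basic_open x rs.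
  rewrite /basic_open /= all_cat mevalD !mevalM -!expr2.
  by rewrite paddr_eq0 ?sqr_ge0 // !sqrf_eq0; case: (_ == 0) (_ == 0) => [] [] //=;
    rewrite andbF.
split=> [[/hasP[pq pqL xpq] /hasP[rs rsL xrs]]|/hasP[_ /allpairsP[[pq rs] /= [pqL rsL
  ->]]]].
  apply/hasP; exists (pq.1 * pq.1 + rs.1 * rs.1, pq.2 ++ rs.2).
    by apply/allpairsP; exists (pq, rs).
  by rewrite [X in is_true X]basicI [basic_open x pq]xpq.
rewrite [X in is_true X -> _]basicI => /andP[xpq xrs].
by split; apply/hasP; [exists pq|exists rs].
Qed.

Lemma semialgebraic_bool (b : bool) : semialgebraic (fun _ : 'I_N -> R => b).
Proof.
exists (if b then [:: (0, [::])] else [::]) => x.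
by case: b; rewrite //= meval0 eqxx.
Qed.

Lemma semialgebraic_eq (p : {mpoly R[N]}) : semialgebraic (fun x => p.@[x] == 0).
Proof. by exists [:: (p, [::])] => x; rewrite /= andbT orbF. Qed.

Lemma semialgebraic_gt (p : {mpoly R[N]}) : semialgebraic (fun x => 0 < p.@[x]).
Proof. by exists [:: (0, [:: p])] => x; rewrite /= meval0 eqxx andbT orbF. Qed.

Definition env x : seq R := [seq x i | i <- enum 'I_N].

Lemma size_env x : size (env x) = N.
Proof. by rewrite size_map size_enum_ord. Qed.

Lemma nth_env x (i : 'I_N) : (env x)`_i = x i.
Proof. by rewrite (nth_map i) ?size_enum_ord // nth_ord_enum. Qed.

Lemma rterm_mpoly (t : term) : GRing.rterm t ->
  exists p : {mpoly R[N]}, forall x, GRing.eval (env x) t = p.@[x].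
Proof.
elim: t => //=.
- move=> i _; have [lti|geN] := ltnP i N.
    by exists 'X_(Ordinal lti) => x; rewrite mevalXU -nth_env.
  by exists 0 => x; rewrite meval0 nth_default // size_env.
- by move=> c _; exists c%:MP => x; rewrite mevalC.
- by move=> m _; exists m%:R => x; rewrite rmorph_nat.
- by move=> t IHt u IHu /andP[/IHt[p hp] /IHu[r hr]]; exists (p + r) => x;
    rewrite mevalD hp hr.
- by move=> t IHt /IHt[p hp]; exists (- p) => x; rewrite mevalN hp.
- by move=> t IHt m /IHt[p hp]; exists (p *+ m) => x; rewrite mevalMn hp.
- by move=> t IHt u IHu /andP[/IHt[p hp] /IHu[r hr]]; exists (p * r) => x;
    rewrite mevalM hp hr.
- by move=> t IHt m /IHt[p hp]; exists (p ^+ m) => x; rewrite rmorphXn /= hp.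
Qed.

(** The complement is carried through the induction because negation and implication need it. *)
Lemma semialgebraic_qf (f : formula) : ord.qf_form f -> ord.rformula f ->
  semialgebraic (fun x => ord.qf_eval (env x) f) /\
  semialgebraic (fun x => ~~ ord.qf_eval (env x) f).
Proof.
elim: f => //=.
- by move=> b _ _; split; apply: semialgebraic_bool.
- move=> t u _ /andP[/rterm_mpoly[p hp] /rterm_mpoly[r hr]]; split.
    by apply: eq_semialgebraic (semialgebraic_eq (p - r)) => x;
      rewrite mevalB subr_eq0 hp hr.
  apply: eq_semialgebraic (semialgebraicU (semialgebraic_gt (p - r)) (semialgebraic_gt (r
    - p))) => x.
  by rewrite !mevalB !subr_gt0 hp hr neq_lt; split=> [[]->|/orP[]->]; rewrite ?orbT; auto.
- move=> t u _ /andP[/rterm_mpoly[p hp] /rterm_mpoly[r hr]]; split.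
    by apply: eq_semialgebraic (semialgebraic_gt (r - p)) => x;
      rewrite mevalB subr_gt0 hp hr.
  apply: eq_semialgebraic (semialgebraicU (semialgebraic_eq (p - r)) (semialgebraic_gt (p
    - r))) => x.
  by rewrite !mevalB subr_eq0 subr_gt0 hp hr -leNgt le_eqVlt eq_sym;
    split=> [[]->|/orP[]->]; rewrite ?orbT; auto.
- move=> t u _ /andP[/rterm_mpoly[p hp] /rterm_mpoly[r hr]]; split.
    apply: eq_semialgebraic (semialgebraicU (semialgebraic_eq (p - r)) (semialgebraic_gt
      (r - p))) => x.
    by rewrite !mevalB subr_eq0 subr_gt0 hp hr le_eqVlt; split=> [[]->|/orP[]->];
      rewrite ?orbT; auto.
  by apply: eq_semialgebraic (semialgebraic_gt (p - r)) => x;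
    rewrite mevalB subr_gt0 hp hr -ltNge.
- move=> f IHf g IHg /andP[qf qg] /andP[rf rg].
  have [[Sf Cf] [Sg Cg]] := (IHf qf rf, IHg qg rg); split.
    by apply: eq_semialgebraic (semialgebraicI Sf Sg) => x; split=> [[-> ->]|/andP].
  by apply: eq_semialgebraic (semialgebraicU Cf Cg) => x; rewrite negb_and; split=> /orP.
- move=> f IHf g IHg /andP[qf qg] /andP[rf rg].
  have [[Sf Cf] [Sg Cg]] := (IHf qf rf, IHg qg rg); split.
    by apply: eq_semialgebraic (semialgebraicU Sf Sg) => x; split=> /orP.
  by apply: eq_semialgebraic (semialgebraicI Cf Cg) => x; rewrite negb_or;
    split=> [[-> ->]|/andP].
- move=> f IHf g IHg /andP[qf qg] /andP[rf rg].
  have [[Sf Cf] [Sg Cg]] := (IHf qf rf, IHg qg rg); split.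
    by apply: eq_semialgebraic (semialgebraicU Cf Sg) => x; rewrite implybE; split=> /orP.
  by apply: eq_semialgebraic (semialgebraicI Sf Cg) => x; rewrite negb_imply;
    split=> [[-> ->]|/andP].
move=> f IHf qf rf; have [Sf Cf] := IHf qf rf; split=> //.
by apply: eq_semialgebraic Sf => x; rewrite negbK.
Qed.

(** The Tarski-Seidenberg principle, from quantifier elimination over real closed fields. *)
Lemma semialgebraic_holds (f : formula) : semialgebraic (fun x => ord.holds (env x) f).
Proof.
have wf := @qe_rcf.wf_QE_wproj R; have valid := @qe_rcf.valid_QE_wproj R.
have rf := ord.to_rform_rformula f.
have /andP[qf' rf'] := ord.quantifier_elim_wf wf rf.
apply: eq_semialgebraic (proj1 (semialgebraic_qf qf' rf')) => x.
exact: (iff_sym (rwP (ord.proj_satP wf valid (env x) f))).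
Qed.

End Semialgebraic.

(** The mere existence of a term or formula suffices for elimination, so big sums and products never
    have to be written out syntactically. *)
Definition definable_fun (F : seq R -> R) :=
  exists t : term, forall e, GRing.eval e t = F e.
Definition definable (P : seq R -> Prop) :=
  exists f : formula, forall e, ord.holds e f <-> P e.

Lemma definable_fun_nth i : definable_fun (fun e => e`_i).
Proof. by exists (GRing.Var R i). Qed.

Lemma definable_fun_const c : definable_fun (fun=> c).
Proof. by exists (GRing.Const c). Qed.

Lemma definable_funD F G : definable_fun F -> definable_fun G ->
  definable_fun (fun e => F e + G e).
Proof. by move=> [t ht] [u hu]; exists (GRing.Add t u) => e; rewrite /= ht hu. Qed.

Lemma definable_funM F G : definable_fun F -> definable_fun G ->
  definable_fun (fun e => F e * G e).
Proof. by move=> [t ht] [u hu]; exists (GRing.Mul t u) => e; rewrite /= ht hu. Qed.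

Lemma definable_funX F m : definable_fun F -> definable_fun (fun e => F e ^+ m).
Proof. by move=> [t ht]; exists (GRing.Exp t m) => e; rewrite /= ht. Qed.

Lemma definable_fun_sum I (r : seq I) (F : I -> seq R -> R) :
  (forall i, definable_fun (F i)) -> definable_fun (fun e => \sum_(i <- r) F i e).
Proof.
move=> hF; elim: r => [|i r [t ht]].
  by have [t ht] := definable_fun_const 0; exists t => e; rewrite big_nil.
have [u hu] := hF i; exists (GRing.Add u t) => e.
by rewrite /= ht hu big_cons.
Qed.

Lemma definable_fun_prod I (r : seq I) (F : I -> seq R -> R) :
  (forall i, definable_fun (F i)) -> definable_fun (fun e => \prod_(i <- r) F i e).
Proof.
move=> hF; elim: r => [|i r [t ht]].
  by have [t ht] := definable_fun_const 1; exists t => e; rewrite big_nil.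
have [u hu] := hF i; exists (GRing.Mul u t) => e.
by rewrite /= ht hu big_cons.
Qed.

Lemma definable_eq F G : definable_fun F -> definable_fun G ->
  definable (fun e => F e = G e).
Proof. by move=> [t ht] [u hu]; exists (ord.Equal t u) => e; rewrite /= ht hu. Qed.

Lemma definable_lt F G : definable_fun F -> definable_fun G ->
  definable (fun e => F e < G e).
Proof. by move=> [t ht] [u hu]; exists (ord.Lt t u) => e; rewrite /= ht hu. Qed.

Lemma definableI P Q : definable P -> definable Q -> definable (fun e => P e /\ Q e).
Proof. by move=> [f hf] [g hg]; exists (ord.And f g) => e; rewrite /= hf hg. Qed.

Lemma definable_forall (I : finType) (P : I -> seq R -> Prop) :
  (forall i, definable (P i)) -> definable (fun e => forall i, P i e).
Proof.
move=> /fin_all_exists[f hf]; exists (foldr (fun i g =>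
  ord.And (f i) g) (ord.Bool true) (enum I)) => e.
suff -> : ord.holds e (foldr (fun i g => ord.And (f i) g) (ord.Bool true) (enum I)) <->
    forall i, i \in enum I -> P i e.
  by split=> [h i|h i _]; [apply: h; rewrite mem_enum|].
elim: (enum I) => [|i r IHr] //=; rewrite hf IHr; split=> [[Pi Pr] j|h].
  by rewrite inE => /orP[/eqP ->|/Pr].
by split=> [|j jr]; apply: h; rewrite inE ?eqxx ?jr ?orbT.
Qed.

(** The variables are quantified one at a time; since [e] has length [N], assigning variable [N]
    appends to it. *)
Lemma exists_block N K (P : seq R -> Prop) : definable P ->
  exists f : formula, forall e, size e = N ->
    (ord.holds e f <-> exists2 s, size s = K & P (e ++ s)).
Proof.
move=> [f hf]; elim: K N => [|K IHK] N.
  exists f => e _; rewrite hf; split=> [Pe|[s /size0nil ->]]; last by rewrite cats0.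
  by exists [::]; rewrite ?cats0.
have [g hg] := IHK N.+1; exists (ord.Exists N g) => e sz /=.
have ext x : set_nth 0 e N x = rcons e x by rewrite -sz; elim: (e) => //= y e' ->.
split=> [[x]|[[|x s] //= [szs] Ps]].
  rewrite ext hg ?size_rcons ?sz // => -[s szs]; rewrite cat_rcons => Ps.
  by exists (x :: s); rewrite //= szs.
by exists x; rewrite ext hg ?size_rcons ?sz //; exists s; rewrite ?cat_rcons.
Qed.

Lemma semialgebraic_exists N K (P : seq R -> Prop) : definable P ->
  semialgebraic (fun x : 'I_N -> R => exists2 s, size s = K & P (env x ++ s)).
Proof.
move=> /(@exists_block N K)[f hf].
by apply: eq_semialgebraic (semialgebraic_holds N f) => x; rewrite hf ?size_env.
Qed.

End QuantifierElimination.

(** * The rational parametrisation of the model *)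

Section Parametrisation.
Variables (R : realType) (n k : nat).
Local Notation N := (2 ^ n)%N.

Definition param := ('I_k * 'I_n + 'I_n + 'I_k)%type.

Lemma card_param : #|{: param}| = (n * k + n + k)%N.
Proof. by rewrite !card_sum card_prod !card_ord [(k * n)%N]mulnC. Qed.

(** The numerator after the substitution of exponentials: a polynomial in the positive variables
    [g]. *)
Definition monomial_numer (g : param -> R) (v : 'I_N) : R :=
  \prod_(j < n) g (inl (inr j)) ^+ bit v j *
  \prod_(i < k) (1 + g (inr i) * \prod_(j < n) g (inl (inl (i, j))) ^+ bit v j).

Definition exp_param (W : 'I_k -> 'I_n -> R) (b : 'I_n -> R) (c : 'I_k -> R) (a : param)
  : R :=
  expR (match a with inl (inl ij) => W ij.1 ij.2 | inl (inr j) => b j | inr i => c i end).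

Lemma numer_monomial W b c : numer W b c =1 monomial_numer (exp_param W b c).
Proof.
move=> v; have expE (z : 'I_n -> R) :
    expR (\sum_(j < n) z j * bitR R v j) = \prod_(j < n) expR (z j) ^+ bit v j.
  by rewrite expR_sum; apply: eq_bigr => j _; rewrite -expRM_natr.
by rewrite /numer expE; congr (_ * _); apply: eq_bigr => i _; rewrite expRD expE.
Qed.

(** Logarithms turn positive [g] into parameters, and multiplying out the normalising constant
    leaves only polynomial conditions. *)
Lemma RBM_modelP (x : 'I_N -> R) : RBM_model k x <->
  exists g : param -> R, (forall a, 0 < g a) /\
    forall v, x v * \sum_w monomial_numer g w = monomial_numer g v.
Proof.
split=> [[W [b [c xE]]]|[g [g0 xE]]].
  exists (exp_param W b c); split=> [a|v]; first exact: expR_gt0.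
  rewrite xE rbm_pE -numer_monomial.
  under [X in _ * X]eq_bigr do rewrite -numer_monomial.
  by rewrite mulfVK // gt_eqF ?sum_numer_gt0.
exists (fun i j => ln (g (inl (inl (i, j))))), (fun j => ln (g (inl (inr j)))),
  (fun i => ln (g (inr i))) => v.
set W := fun i j => _; set b := fun j => _; set c := fun i => _.
have gE w : numer W b c w = monomial_numer g w.
  have lnE a : exp_param W b c a = g a.
    by case: a => [[[i j]|j]|i]; rewrite /exp_param /= lnK // posrE.
  rewrite numer_monomial /monomial_numer; congr (_ * _).
    by apply: eq_bigr => j _; rewrite lnE.
  by apply: eq_bigr => i _; rewrite lnE; under eq_bigr do rewrite lnE.
have sumE : \sum_w numer W b c w = \sum_w monomial_numer g w by apply: eq_bigr => w _.
by rewrite rbm_pE gE -xE sumE mulfK // -sumE gt_eqF ?sum_numer_gt0.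
Qed.

Lemma RBM_model_sum1 (x : 'I_N -> R) : RBM_model k x -> \sum_(v < N) x v = 1.
Proof.
move=> [W [b [c xE]]]; under eq_bigr do rewrite xE rbm_pE.
by rewrite -mulr_suml divff // gt_eqF ?sum_numer_gt0.
Qed.

Lemma no_chain_param : ~ prime_chain_over (@RBM_model R n k) (n * k + n + k).+1.
Proof.
rewrite -card_param; pose X := (('I_k -> 'I_n -> R) * ('I_n -> R) * ('I_k -> R))%type.
pose g (x : X) := exp_param x.1.1 x.1.2 x.2.
pose t (x : X) (i : 'I_#|{: param}|) := g x (enum_val i).
have ratfun_g a : ratfun t (fun x => g x a).
  by apply: eq_ratfun (ratfun_coord t (enum_rank a)) => x; rewrite /t enum_rankK.
have ratfun_numer v : ratfun t (fun x => monomial_numer (g x) v).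
  apply: ratfunM; first by apply: ratfun_prod => j; apply: ratfunX.
  apply: ratfun_prod => i; apply: ratfunD; first exact: ratfun_const.
  by apply: ratfunM => //; apply: ratfun_prod => j; apply: ratfunX.
apply: (@chain_length_bound _ _ _ X _ t (fun x v => rbm_p x.1.1 x.1.2 x.2 v)).
  move=> v; apply: (@eq_ratfun _ _ _ _
    (fun x => monomial_numer (g x) v / \sum_w monomial_numer (g x) w)).
    move=> x; rewrite rbm_pE numer_monomial; congr (_ / _).
    by apply: eq_bigr => w _; rewrite numer_monomial.
  apply: ratfunM => //; apply: ratfunV; last exact: ratfun_sum.
  move=> x; rewrite gt_eqF //; under eq_bigr do rewrite -numer_monomial.
  exact: sum_numer_gt0.
by move=> y [W [b [c yE]]]; exists (W, b, c) => v; apply: yE.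
Qed.

Lemma semialgebraic_RBM : semialgebraic (@RBM_model R n k).
Proof.
(* The first [N] entries of [e] hold the point of the simplex, and the parameters follow. *)
pose g (e : seq R) (a : param) := e`_(N + enum_rank a).
have def_g a : definable_fun (fun e => g e a) by exists (GRing.Var R (N + enum_rank a)).
have def_numer v : definable_fun (fun e => monomial_numer (g e) v).
  apply: definable_funM; first by apply: definable_fun_prod => j; apply: definable_funX.
  apply: definable_fun_prod => i; apply: definable_funD; first exact: definable_fun_const.
  by apply: definable_funM => //; apply: definable_fun_prod => j; apply: definable_funX.
pose P e := (forall a, 0 < g e a) /\
  forall v : 'I_N, e`_v * \sum_w monomial_numer (g e) w = monomial_numer (g e) v.
have def_P : definable P.
  apply: definableI; apply: definable_forall => a.
    by apply: definable_lt => //; apply: definable_fun_const.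
  apply: definable_eq => //; apply: definable_funM; first exact: definable_fun_nth.
  exact: definable_fun_sum.
apply: eq_semialgebraic (semialgebraic_exists N #|{: param}| def_P) => x.
have envE s (v : 'I_N) : (env x ++ s)`_v = x v.
  by rewrite nth_cat size_env ltn_ord nth_env.
have gE s : g (env x ++ s) =1 fun a => s`_(enum_rank a).
  by move=> a; rewrite /g nth_cat size_env ltnNge leq_addr /= addKn.
have numerE (g1 g2 : param -> R) : g1 =1 g2 -> monomial_numer g1 =1 monomial_numer g2.
  move=> e v; rewrite /monomial_numer; congr (_ * _).
    by apply: eq_bigr => j _; rewrite e.
  by apply: eq_bigr => i _; rewrite e; under eq_bigr do rewrite e.
rewrite RBM_modelP; split=> [[s _ [g0 xE]]|[f [f0 xE]]].
  by exists (g (env x ++ s)); split=> // v; rewrite -xE envE.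
exists [seq f (enum_val i) | i <- enum 'I_#|{: param}|].
  by rewrite size_map size_enum_ord.
have fE : g (env x ++ [seq f (enum_val i) | i <- enum 'I_#|{: param}|]) =1 f.
  move=> a; rewrite gE (nth_map (enum_rank a)) ?size_enum_ord //.
  by rewrite nth_ord_enum enum_rankK.
split=> [a|v]; first by rewrite fE.
by rewrite envE (numerE _ _ fE) -xE; congr (_ * _); apply: eq_bigr => w _; apply: numerE.
Qed.

End Parametrisation.

(** All coordinates but the last parametrise the hyperplane of total mass 1. *)
Lemma no_chain_sum1 (R : realType) N (S : ('I_N -> R) -> Prop) :
  (forall x, S x -> \sum_v x v = 1) -> ~ prime_chain_over S N.-1.+1.
Proof.
case: N S => [|N] S sum1.
  (* Without coordinates the empty sum is not 1, so [S] is empty and its vanishing ideal contains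
     1. *)
  case=> P [primeP PS _ _]; have [_ P1 _ _ _] := primeP 0%N isT; apply: P1.
  by apply: PS => // x /sum1; rewrite big_ord0 => /esym/eqP; rewrite oner_eq0.
pose t (x : 'I_N -> R) := x.
pose phi (x : 'I_N -> R) (v : 'I_N.+1) :=
  if unlift ord_max v is Some i then x i else 1 - \sum_i x i.
apply: (@chain_length_bound _ _ _ _ _ t phi).
  move=> v; rewrite /phi; case: (unlift _ v) => [i|]; first exact: ratfun_coord.
  apply: (@eq_ratfun _ _ _ _ (fun x : 'I_N -> R => 1 + -1 * \sum_i t x i)).
    by move=> x; rewrite mulN1r.
  apply: ratfunD; first exact: ratfun_const.
  apply: ratfunM; first exact: ratfun_const.
  by apply: ratfun_sum => i; apply: ratfun_coord.
move=> y /sum1 sumy; exists (fun i => y (lift ord_max i)) => v; rewrite /phi.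
case: unliftP => [i ->|->] //.
have -> : \sum_(i < N) y (lift ord_max i) = \sum_(i < N) y (widen_ord (leqnSn N) i).
  by apply: eq_bigr => i _; congr y; apply/val_inj; rewrite /= /bump leqNgt ltn_ord.
by move: sumy; rewrite big_ord_recr /= => <-; rewrite addrAC subrr add0r.
Qed.

(** * Slicings of the cube *)

(** Full column rank provides an invertible square submatrix; [f] selects its rows, and the columns
    of its inverse are the dual vectors. *)
Lemma dual_vectors_of_col_inj (F : fieldType) (V P : finType) (A : V -> P -> F) :
  (forall u : P -> F, (forall v, \sum_p A v p * u p = 0) -> forall p, u p = 0) ->
  exists (f : 'I_#|P| -> V) (B : 'I_#|P| -> P -> F),
    forall i j, \sum_p A (f i) p * B j p = (i == j)%:R.
Proof.
move=> injA; pose M := \matrix_(i < #|V|, j < #|P|) A (enum_val i) (enum_val j).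
have fullM : row_full M.
  rewrite -col_leq_rank leqNgt; apply/negP => ltM.
  have /matrix0Pn[i [j kerN0]] : kermx M^T != 0.
    by rewrite -mxrank_eq0 mxrank_ker subn_eq0 -ltnNge mxrank_tr.
  move/negP: kerN0; apply; apply/eqP.
  have ker0 : kermx M^T *m M^T = 0 by apply: mulmx_ker.
  rewrite -(enum_valK j); apply: (injA (fun p => kermx M^T i (enum_rank p))) => v.
  have := congr1 (fun X : 'M_(_, _) => X i (enum_rank v)) ker0; rewrite /= [RHS]mxE mxE.
  move=> h; rewrite -[RHS]h (reindex (@enum_val P P)) /=; last first.
    by apply: onW_bij; apply: enum_val_bij.
  by apply: eq_bigr => l _; rewrite mulrC enum_valK [M^T _ _]mxE [M _ _]mxE enum_rankK.
pose g := fullrankfun fullM.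
have unitM : rowsub g M \in unitmx := fullrowsub_unit fullM.
exists (fun i => enum_val (g i)), (fun j p => invmx (rowsub g M) (enum_rank p) j) => i j.
have := congr1 (fun X : 'M_(_, _) => X i j) (mulmxV unitM); rewrite /= [RHS]mxE mxE => h.
rewrite -[RHS]h (reindex (@enum_val P P)) /=; last first.
  by apply: onW_bij; apply: enum_val_bij.
by apply: eq_bigr => l _; rewrite enum_valK [rowsub _ _ _ _]mxE [M _ _]mxE.
Qed.

Lemma common_denominator (T : finType) (f : T -> rat) :
  exists (q : nat) (z : T -> int), (0 < q)%N /\ forall t, q%:R * f t = (z t)%:~R.
Proof.
exists (\prod_t `|denq (f t)|)%N.
exists (fun t => (\prod_(u | u != t) `|denq (f u)|)%N%:Z * numq (f t)); split.
  by rewrite prodn_gt0 // => t; rewrite absz_gt0 denq_neq0.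
move=> t; rewrite (bigD1 t) //= natrM rmorphM /= -[X in X * _](mulrC).
rewrite -mulrA; congr (_ * _).
by rewrite natr_absz normr_denq numqE mulrC.
Qed.

(** * The slicing matrix and its rank *)

Section Slicing.
Variables (n k : nat).
Local Notation N := (2 ^ n)%N.

Definition affine (W : 'I_n -> int) (c : int) (x : cube n) : int :=
  c + \sum_(j < n) W j * (x j : nat)%:Z.

Definition threshold (h : cube n -> bool) := exists W c, forall x,
  if h x then 0 < affine W c x else affine W c x < 0.

Variable H : 'I_k -> cube n -> bool.

Definition slice_index := (option 'I_k * option 'I_n)%type.

(* The entries of (1, x) (x) (1, H x); [None] stands for the constant coordinate. *)
Definition slice_entry (x : cube n) (p : slice_index) : bool :=
  oapp (H^~ x) true p.1 && oapp x true p.2.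

Definition slice_comb (F : nzRingType) (u : slice_index -> F) (x : cube n) : F :=
  \sum_p (slice_entry x p)%:R * u p.

Lemma sum_option (V : nmodType) (I : finType) (G : option I -> V) :
  \sum_o G o = G None + \sum_i G (Some i).
Proof.
rewrite (bigD1 None) //=; congr (_ + _).
rewrite (reindex_omap Some id) /=; last by case.
by apply: eq_bigl => i; rewrite eqxx.
Qed.

Lemma slice_combE (F : nzRingType) (u : slice_index -> F) x :
  slice_comb u x = u (None, None) + \sum_j (x j)%:R * u (None, Some j) +
    \sum_i (H i x)%:R * (u (Some i, None) + \sum_j (x j)%:R * u (Some i, Some j)).
Proof.
have -> : slice_comb u x = \sum_a \sum_b (slice_entry x (a, b))%:R * u (a, b).
  by rewrite pair_bigA; apply: eq_bigr => -[a b].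
rewrite sum_option sum_option {1}/slice_entry /= mul1r; congr (_ + _).
apply: eq_bigr => i _; rewrite sum_option /slice_entry /= andbT mulrDr; congr (_ + _).
rewrite big_distrr /=; apply: eq_bigr => j _.
by case: (H i x); rewrite ?mul1r ?mul0r.
Qed.

(** Direction 0 realises the slices by affine functions; the other directions are the dual vectors,
    scaled to integers. *)
Lemma prime_chain_of_slicing (R : realType) d (f : 'I_d.+1 -> cube n)
    (B : 'I_d.+1 -> slice_index -> rat) :
  (0 < d)%N -> (forall i, threshold (H i)) ->
  (forall i j, slice_comb (B j) (f i) = (i == j)%:R) ->
  prime_chain_over (@RBM_model R n k) d.
Proof.
move=> d0 thH dual.
have [W0 /fin_all_exists[c0 Hth]] := fin_all_exists thH.
case: (bits_bij n) => dec bitsK decK.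
have [q [z [q0 zE]]] := common_denominator (fun jp : 'I_d.+1 * slice_index =>
  B jp.1 jp.2).
(* Direction [a > 0] uses dual vector [a + 1], which is 1 at vertex [a + 1] and 0 at the other
   chosen vertices, the base vertex included. *)
pose zz a p := z (inord a.+1, p).
pose h i (v : 'I_N) := H i (bits v).
pose vs l := dec (f (inord l)).
pose zW a i j := if a == 0%N then W0 i j else zz a (Some i, Some j).
pose zc a i := if a == 0%N then c0 i else zz a (Some i, None).
have affineE v i : affine (W0 i) (c0 i) (bits v) = activ zW zc 0 i v.
  by rewrite /affine /activ /zc /zW; congr (_ + _); apply: eq_bigr => j _; rewrite ffunE.
pose l0 : 'I_d.+1 := inord 0; pose l1 : 'I_d.+1 := inord 1.
have [j0 neq_j0] : exists j, f l1 j != f l0 j.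
  apply/existsP; rewrite -negb_forall; apply/negP => /forallP e.
  have e10 : f l1 = f l0 by apply/ffunP => j; apply/eqP.
  have /negbTE ne10 : l1 != l0 by rewrite -val_eqE /= !inordK ?ltnS.
  have /eqP := dual l0 l0.
  by rewrite eqxx -e10 dual ne10 eq_sym oner_eq0.
(* The visible bias of direction 0 is free. It is zero if the hidden part [beta] already separates
   [vs 1] from [vs 0], and otherwise the unit vector at a coordinate [j0] where these vertices
   differ. *)
pose beta v : int := \sum_(i < k) activ zW zc 0 i v *+ h i v.
pose zb a j : int := if a == 0%N then ((j == j0) && (beta (vs 1%N) == beta (vs 0%N)))%:R
  else zz a (None, Some j).
apply: (@prime_chain_over_RBM R n k zW zb zc h d q vs) => //.
- by move=> i v; rewrite -affineE; apply: Hth.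
- move=> a i a0 lta lti.
  (* The constant column corresponds to no parameter of the model; its coefficient cancels in
     differences of exponents. *)
  have expoE x : (expo zW zb zc h a x + zz a (None, None))%:~R = q%:R * slice_comb (B
    (inord a.+1)) (bits x) :> rat.
    rewrite addrC slice_combE /expo addrA rmorphD !mulrDr /=; congr (_ + _).
      rewrite rmorphD /= /zz -zE /=; congr (_ + _).
      rewrite /bias rmorph_sum big_distrr /=; apply: eq_bigr => j _.
      by rewrite rmorphM /= /zb gtn_eqF // /zz -zE ffunE mulrAC mulrA.
    rewrite rmorph_sum big_distrr /=; apply: eq_bigr => o _.
    rewrite -[activ _ _ _ _ _ *+ _]mulr_natr rmorphM /= mulrCA [LHS]mulrC rmorph_nat;
      congr (_ * _).
    rewrite /activ rmorphD /= mulrDr /zc gtn_eqF // /zz -zE /=; congr (_ + _).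
    rewrite rmorph_sum big_distrr /=; apply: eq_bigr => j _.
    by rewrite rmorphM /= /zW gtn_eqF // /zz -zE ffunE mulrAC mulrA.
  apply/eqP; rewrite -(eqr_int rat); apply/eqP.
  rewrite -[expo _ _ _ _ _ (vs i.+1)](addrK (zz a (None, None))) -addrA -opprD addrC.
  rewrite [_ + expo _ _ _ _ _ _]addrC addrC rmorphB /= !expoE /vs !decK !dual.
  rewrite -!val_eqE /= !inordK ?ltnS // eqSS mulr0 subr0 -[RHS]/((q * _)%N%:R) natrM //.
- rewrite /expo -/(beta _) -/(beta _).
  have biasE v : bias zb 0 v = (bits v j0 && (beta (vs 1%N) == beta (vs 0%N)))%:R.
    rewrite /bias (bigD1 j0) //= big1 ?addr0.
      by rewrite /zb /= eqxx /bitZ ffunE; case: (_ == _); case: (bit _ _).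
    by move=> j /negbTE nej; rewrite /zb /= nej mul0r.
  rewrite !biasE; have [eqb|neqb] := eqVneq (beta (vs 1%N)) (beta (vs 0%N)).
    rewrite !andbT eqb => /addIr; rewrite /vs !decK -/l0 -/l1.
    by move: neq_j0; case: (f l1 j0); case: (f l0 j0).
  by rewrite !andbF !add0r; apply/eqP.
Qed.

(** The [(n + 1) * (k + 1)] independent columns give as many independent rows at distinct vertices,
    which also bounds their number by [2 ^ n]. *)
Lemma prime_chain_of_col_inj (R : realType) :
  (0 < n)%N -> (forall i, threshold (H i)) ->
  (forall u : slice_index -> rat, (forall x, slice_comb u x = 0) -> forall p, u p = 0) ->
  prime_chain_over (@RBM_model R n k) (n * k + n + k) /\ (n * k + n + k < 2 ^ n)%N.
Proof.
move=> n0 Hth injH; have [f [B dual]] := dual_vectors_of_col_inj injH.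
have cardP : #|{: slice_index}| = (n * k + n + k).+1.
  by rewrite card_prod !card_option !card_ord; nia.
move: f B dual; rewrite cardP => f B dual; split.
  by apply: prime_chain_of_slicing dual => //; rewrite addn_gt0 addn_gt0 n0 orbT.
have inj_f : injective f.
  move=> i j eij; have := dual i j; rewrite eij dual eqxx.
  by case: eqP => // _ /eqP; rewrite oner_eq0.
by have := leq_card f inj_f; rewrite card_ord card_ffun card_bool card_ord.
Qed.

(** The vectors [u y] form a right inverse of the matrix, so all [2 ^ n] rows serve and there are at
    least as many columns. *)
Lemma prime_chain_of_row_surj (R : realType) :
  (0 < n)%N -> (forall i, threshold (H i)) ->
  (forall y, exists u : slice_index -> rat, forall x, slice_comb u x = (x == y)%:R) ->
  prime_chain_over (@RBM_model R n k) (2 ^ n).-1 /\ ((2 ^ n).-1 <= n * k + n + k)%N.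
Proof.
move=> n0 Hth /fin_all_exists[u uE].
have cardV : #|{: cube n}| = (2 ^ n).-1.+1.
  by rewrite card_ffun card_bool card_ord prednK // expn_gt0.
pose f : 'I_#|{: cube n}| -> cube n := enum_val.
pose B (i : 'I_#|{: cube n}|) := u (f i).
have dual i j : slice_comb (B j) (f i) = (i == j)%:R.
  by rewrite /B uE /f (inj_eq enum_val_inj).
split.
  move: f B dual; rewrite cardV => f B dual.
  apply: prime_chain_of_slicing dual => //.
  by rewrite -ltnS prednK ?expn_gt0 // -{1}(expn0 2) ltn_exp2l.
pose A := \matrix_(i < #|{: cube n}|, p < #|{: slice_index}|) (slice_entry (f i)
  (enum_val p))%:R : 'M[rat]_(_, _).
pose C := \matrix_(p < #|{: slice_index}|, j < #|{: cube n}|) B j (enum_val p).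
have AC : A *m C = 1%:M.
  apply/matrixP => i j; rewrite !mxE -dual /slice_comb.
  rewrite [RHS](reindex (fun l : 'I_#|{: slice_index}| => enum_val l)) /=; last first.
    by apply: onW_bij; apply: enum_val_bij.
  by apply: eq_bigr => p _; rewrite !mxE.
have := mulmx1_min AC.
by rewrite cardV card_prod !card_option !card_ord; nia.
Qed.

End Slicing.

(** * Hamming balls of radius one as slices *)

Section HammingBalls.
Variable n : nat.
Implicit Types (x y z : cube n).

Definition ball y x := (\sum_(j < n) (x j != y j) <= 1)%N.
Definition unit_vec (j : 'I_n) : cube n := [ffun i => i == j].
Definition xadd x y : cube n := [ffun j => x j (+) y j].

Lemma xaddK y : involutive (xadd^~ y).
Proof. by move=> x; apply/ffunP => j; rewrite !ffunE addbK. Qed.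

Lemma xadd_unit_eq y i j : (xadd y (unit_vec i) == xadd y (unit_vec j)) = (i == j).
Proof.
apply/eqP/eqP => [/ffunP e|-> //]; apply/eqP.
by have := e i; rewrite !ffunE eqxx => /addbI <-.
Qed.

Lemma xadd_unit_neq y j : (xadd y (unit_vec j) == y) = false.
Proof.
apply/eqP => /ffunP e; have := e j; rewrite !ffunE eqxx addbT.
by case: (y j).
Qed.

Lemma ballP y x : reflect (x = y \/ exists j, x = xadd y (unit_vec j)) (ball y x).
Proof.
apply: (iffP idP) => [|[->|[j ->]]].
- rewrite /ball; have [/existsP[j nej]|] := boolP [exists j, x j != y j].
    rewrite (bigD1 j) //= nej add1n ltnS leqn0 sum_nat_eq0 => /forallP rest.
    right; exists j; apply/ffunP => i; rewrite !ffunE.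
    have [->|neij] := eqVneq i j; first by move: nej; case: (x j); case: (y j).
    by have := rest i; rewrite neij eqb0 negbK addbF => /eqP.
  by rewrite negb_exists => /forallP e _; left; apply/ffunP => j; apply/eqP/negPn.
- by rewrite /ball big1 // => j _; rewrite eqxx.
rewrite /ball (bigD1 j) //= big1 ?addn0 ?leq_b1 // => i /negbTE neij.
by rewrite !ffunE neij addbF eqxx.
Qed.

Lemma threshold_ball y : threshold (ball y).
Proof.
(* The affine function is 3 minus twice the Hamming distance to [y]: positive up to distance 1,
   negative from distance 2 on. *)
pose W j : int := if y j then 2 else -2.
exists W, (3 - 2 * \sum_(j < n) (y j : nat)%:Z) => x.
have -> : affine W (3 - 2 * \sum_(j < n) (y j : nat)%:Z) x =
    3 - 2 * (\sum_(j < n) (x j != y j))%N%:Z.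
  rewrite /affine PoszSum !big_distrr /= -addrA -sumrN -big_split -sumrN /=.
  congr (_ + _); apply: eq_bigr => j _; rewrite /W.
  by case: (x j); case: (y j).
by rewrite /ball; case: leqP; lia.
Qed.

(** In other words, [A] affinely spans the whole space. *)
Definition affine_zero_on (A : cube n -> Prop) :=
  forall (a : rat) (b : 'I_n -> rat), (forall x, A x -> a + \sum_j (x j)%:R * b j = 0) ->
  a = 0 /\ forall j, b j = 0.

Lemma affine_zero_on_ball y : affine_zero_on (ball y).
Proof.
move=> a b van; have vy : a + \sum_j (y j)%:R * b j = 0 by apply/van/ballP; left.
have b0 j : b j = 0.
  have : a + \sum_i (xadd y (unit_vec j) i)%:R * b i = 0 by apply/van/ballP; right;
    exists j.
  move: vy; rewrite (bigD1 j) //= [in X in _ -> X -> _](bigD1 j) //= !ffunE eqxx addbT.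
  rewrite [in X in _ -> X -> _](eq_bigr (fun i => (y i)%:R * b i)); last first.
    by move=> i /negbTE neij; rewrite !ffunE neij addbF.
  by case: (y j); rewrite /= ?mul1r ?mul0r; lra.
split=> //; move: vy; rewrite big1 ?addr0 // => j _; by rewrite b0 mulr0.
Qed.

Section Slices.
Variable k : nat.
Variable C : 'I_k -> cube n.
Let H i := ball (C i).

(** Outside the balls only the constant block contributes, so it vanishes first; inside a ball,
    disjointness then leaves the block of that ball alone. *)
Lemma col_inj_balls :
  (forall i i' x, ball (C i) x -> ball (C i') x -> i = i') ->
  affine_zero_on (fun x => forall i, ~~ ball (C i) x) ->
  forall u : slice_index n k -> rat, (forall x, slice_comb H u x = 0) -> forall p, u p =
    0.
Proof.
move=> disj out u u0.
have [a0 b0] : u (None, None) = 0 /\ forall j, u (None, Some j) = 0.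
  apply: out => x xout; rewrite -[RHS](u0 x) slice_combE [X in _ = _ + X]big1 ?addr0 //.
  by move=> i _; rewrite /H (negbTE (xout i)) mul0r.
have ab i : u (Some i, None) = 0 /\ forall j, u (Some i, Some j) = 0.
  apply: (affine_zero_on_ball (y := C i)) => x xi; have := u0 x.
  rewrite slice_combE a0 add0r big1 ?add0r => [|j _]; last by rewrite b0 mulr0.
  rewrite (bigD1 i) //= /H xi mul1r [X in _ + X]big1 ?addr0 // => i' nei'.
  case: (boolP (ball (C i') x)) => [xi'|_]; last by rewrite mul0r.
  by rewrite (disj _ _ _ xi' xi) eqxx in nei'.
by case=> -[i|] [j|] //; [have [_] := ab i | have [] := ab i].
Qed.

(** On a ball, the indicator of the centre is 1 minus the distance to it, and that of a neighbour
    tests one coordinate. Both are affine, and the slice cuts them off outside the ball. *)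
Lemma row_surj_ball y i : ball (C i) y ->
  exists u : slice_index n k -> rat, forall x, slice_comb H u x = (x == y)%:R.
Proof.
move=> yi.
have [a [b abE]] : exists (a : rat) (b : 'I_n -> rat),
    forall x, ball (C i) x -> a + \sum_j (x j)%:R * b j = (x == y)%:R.
  have distE x j : (x j != C i j)%:R = (C i j)%:R + (x j)%:R * (1 - 2 * (C i j)%:R) :>
    rat.
    by case: (x j); case: (C i j); rewrite /= ?mul1r ?mul0r ?mulr0 ?mulr1; lra.
  have [->|[j ->]] := ballP _ _ yi.
    exists (1 - \sum_j (C i j)%:R), (fun j => - (1 - 2 * (C i j)%:R)) => x /ballP xi.
    have -> : 1 - \sum_j (C i j)%:R + \sum_j (x j)%:R * - (1 - 2 * (C i j)%:R) =
        1 - \sum_j (x j != C i j)%:R :> rat.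
      rewrite -addrA; congr (1 + _); rewrite [in RHS](eq_bigr _ (fun j _ => distE x j)).
      rewrite big_split opprD /=; congr (_ + _).
      by rewrite -sumrN; apply: eq_bigr => j _; rewrite mulrN.
    case: xi => [->|[j ->]].
      by rewrite eqxx big1 ?subr0 // => j _; rewrite eqxx.
    rewrite (bigD1 j) //= big1 ?addr0 => [|l /negbTE nelj];
      last by rewrite !ffunE nelj addbF eqxx.
    by rewrite xadd_unit_neq !ffunE eqxx addbT; case: (C i j); rewrite /= subrr.
  exists (C i j)%:R, (fun l => if l == j then 1 - 2 * (C i j)%:R else 0) => x /ballP xi.
  rewrite (bigD1 j) //= eqxx big1 => [|l /negbTE ->]; last by rewrite mulr0.
  rewrite addr0 -distE; congr (nat_of_bool _)%:R; case: xi => [->|[l ->]].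
    by rewrite eqxx eq_sym xadd_unit_neq.
  by rewrite xadd_unit_eq !ffunE [RHS]eq_sym; case: (j == l); case: (C i j).
pose u (p : slice_index n k) : rat :=
  if p.1 == Some i then oapp b a p.2 else 0.
exists u => x; rewrite slice_combE /u /= add0r big1 ?add0r => [|j _];
  last by rewrite mulr0.
rewrite (bigD1 i) //= eqxx [X in _ + X]big1 ?addr0 => [|i' nei']; last first.
  have -> : (Some i' == Some i) = false by apply: negbTE.
  by rewrite add0r big1 ?mulr0 // => j _; rewrite mulr0.
rewrite /H; have [xi|nxi] := boolP (ball (C i) x); first by rewrite mul1r abE.
by rewrite mul0r; case: eqP => // exy; rewrite exy yi in nxi.
Qed.

(** One vertex [z] may stay uncovered: its indicator is 1 minus the sum of all the others. *)
Lemma row_surj_balls z :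
  (forall x, x != z -> exists i, ball (C i) x) ->
  forall y, exists u : slice_index n k -> rat, forall x, slice_comb H u x = (x == y)%:R.
Proof.
move=> cover.
have /fin_all_exists[u uE] : forall y, exists u : slice_index n k -> rat,
    y != z -> forall x, slice_comb H u x = (x == y)%:R.
  move=> y; have [->|/cover[i yi]] := eqVneq y z; first by exists (fun=> 0).
  by have [u uE] := row_surj_ball yi; exists u.
move=> y; have [->|/uE yu] := eqVneq y z; last by exists (u y).
exists (fun p => (p == (None, None))%:R - \sum_(y | y != z) u y p) => x.
have -> : slice_comb H (fun p => (p == (None, None))%:R - \sum_(y | y != z) u y p) x =
    slice_comb H (fun p => (p == (None, None))%:R) x - \sum_(y | y != z) slice_comb H (u
      y) x.
  rewrite /slice_comb exchange_big /= -sumrB; apply: eq_bigr => p _.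
  by rewrite mulrBr big_distrr.
have -> : slice_comb H (fun p => (p == (None, None))%:R) x = 1 :> rat.
  rewrite slice_combE eqxx [X in _ + X + _]big1 => [|j _]; last by rewrite mulr0.
  rewrite [X in _ + X]big1 ?addr0 // => i _.
  by rewrite add0r big1 ?mulr0 // => j _; rewrite mulr0.
rewrite (eq_bigr (fun y => (x == y)%:R)); last by move=> w /uE ->.
have [->|nexz] := eqVneq x z.
  by rewrite big1 ?subr0 // => w /negbTE; rewrite eq_sym => ->.
rewrite (bigD1 x) //= eqxx big1 ?addr0 ?subrr // => w /andP[_ /negbTE].
by rewrite eq_sym => ->.
Qed.

End Slices.
End HammingBalls.

(** * Binary linear codes given by a parity check *)

Section LinearCodes.
Variables (n : nat) (G : finZmodType) (col : 'I_n -> G).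
Hypothesis addgg : forall g : G, g + g = 0.
Implicit Types (x y z : cube n).

(** The syndrome, for the parity check matrix with columns [col]; [G] plays the role of a vector
    space over the field with two elements. *)
Definition synd x : G := \sum_j col j *+ x j.
Definition code : {set cube n} := [set x | synd x == 0].

Lemma synd_xadd x y : synd (xadd x y) = synd x + synd y.
Proof.
rewrite /synd -big_split /=; apply: eq_bigr => j _; rewrite ffunE.
by case: (x j); case: (y j); rewrite /= ?addr0 ?add0r ?mulr1n ?addgg.
Qed.

Lemma synd_unit_vec j : synd (unit_vec j) = col j.
Proof.
rewrite /synd (bigD1 j) //= big1 ?addr0 => [|i /negbTE nei]; first by rewrite ffunE eqxx.
by rewrite ffunE nei.
Qed.

Lemma oppg (g : G) : - g = g.
Proof. by apply/esym/eqP; rewrite -addr_eq0 addgg. Qed.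

Lemma sum_card_synd : (\sum_g #|[set x | synd x == g]| = 2 ^ n)%N.
Proof.
have <- : #|{: cube n}| = (2 ^ n)%N by rewrite card_ffun card_bool card_ord.
rewrite -sum1_card (partition_big synd xpredT) //=; apply: eq_bigr => g _.
by rewrite -sum1_card; apply: eq_bigl => x; rewrite inE.
Qed.

(** Translation by one of its points embeds each nonempty syndrome class into the code. *)
Lemma card_code_ge : (2 ^ n <= #|G| * #|code|)%N.
Proof.
rewrite -sum_card_synd -sum_nat_const; apply: leq_sum => g _.
case: (set_0Vmem [set x | synd x == g]) => [->|[y]]; first by rewrite cards0.
rewrite inE => /eqP yg.
rewrite -(card_imset _ (can_inj (xaddK y))); apply: subset_leq_card.
apply/subsetP => ? /imsetP[x xS ->]; move: xS; rewrite !inE => /eqP xg.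
by rewrite synd_xadd xg yg addgg.
Qed.

(** Every nonzero syndrome is a column, so flipping that bit embeds the code into each class. *)
Lemma card_code_le : (forall g, g != 0 -> exists j, col j = g) ->
  (#|G| * #|code| <= 2 ^ n)%N.
Proof.
move=> cover; rewrite -sum_card_synd -sum_nat_const; apply: leq_sum => g _.
have [-> //|/cover[j <-]] := eqVneq g 0.
rewrite -(card_imset code (can_inj (xaddK (unit_vec j)))); apply: subset_leq_card.
apply/subsetP => ? /imsetP[x xS ->]; move: xS; rewrite !inE => /eqP x0.
by rewrite synd_xadd synd_unit_vec x0 add0r.
Qed.

Variable k : nat.
(** If [k] exceeds the size of the code, the surplus balls are centred at the zero word. *)
Definition codeword (i : 'I_k) : cube n := nth [ffun=> false] (enum code) i.

Lemma codeword_in i : (k <= #|code|)%N -> codeword i \in code.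
Proof. by move=> lek; rewrite -mem_enum mem_nth // -cardE (leq_trans (ltn_ord i)). Qed.

Lemma codeword_onto c : (#|code| <= k)%N -> c \in code -> exists i, codeword i = c.
Proof.
move=> lek cc; have lti : (index c (enum code) < k)%N.
  by apply: leq_trans lek; rewrite cardE index_mem mem_enum.
by exists (Ordinal lti); rewrite /codeword nth_index // mem_enum.
Qed.

Lemma codeword_inj : (k <= #|code|)%N -> injective codeword.
Proof.
move=> lek i i' /eqP; rewrite nth_uniq ?enum_uniq -?cardE ?(leq_trans (ltn_ord _)) //.
by move=> /eqP/val_inj.
Qed.

Lemma row_surj_Hamming : (forall g, g != 0 -> exists j, col j = g) -> (#|code| <= k)%N ->
  forall y, exists u : slice_index n k -> rat,
    forall x, slice_comb (fun i => ball (codeword i)) u x = (x == y)%:R.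
Proof.
move=> cover lek y; suff [i yi] : exists i, ball (codeword i) y by apply: row_surj_ball
  yi.
have [y0|/cover[j colj]] := eqVneq (synd y) 0.
  have [i iE] : exists i, codeword i = y by apply: codeword_onto; rewrite // inE y0.
  by exists i; apply/ballP; left.
have [i iE] : exists i, codeword i = xadd y (unit_vec j).
  by apply: codeword_onto => //; rewrite inE synd_xadd synd_unit_vec colj addgg.
by exists i; apply/ballP; right; exists j; rewrite iE xaddK.
Qed.

Hypotheses (col_inj : injective col) (col_neq0 : forall j, col j != 0).

Lemma synd_ball c x : c \in code -> ball c x ->
  synd x = 0 /\ c = x \/ exists j, synd x = col j /\ c = xadd x (unit_vec j).
Proof.
rewrite inE => /eqP c0 /ballP[->|[j ->]]; first by left.
by right; exists j; rewrite xaddK synd_xadd synd_unit_vec c0 add0r.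
Qed.

(** The syndrome of [x] tells which bit, if any, leads back to the centre, as the columns are
    distinct and nonzero. *)
Lemma disjoint_balls c c' x : c \in code -> c' \in code ->
  ball c x -> ball c' x -> c = c'.
Proof.
move=> cc cc' /(synd_ball cc)[[x0 ->]|[j [xj ->]]] /(synd_ball cc')[[x0' ->]|[j' [xj'
  ->]]] //.
- by have := col_neq0 j'; rewrite -xj' x0 eqxx.
- by have := col_neq0 j; rewrite -xj x0' eqxx.
by congr (xadd x (unit_vec _)); apply: col_inj; rewrite -xj.
Qed.

Lemma col_inj_Hamming (u : slice_index n k -> rat) : (k <= #|code|)%N ->
  affine_zero_on (fun x => forall i, ~~ ball (codeword i) x) ->
  (forall x, slice_comb (fun i => ball (codeword i)) u x = 0) -> forall p, u p = 0.
Proof.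
move=> lek out u0; apply: (col_inj_balls _ out u0) => i i' x xi xi'.
by apply: (codeword_inj lek); apply: disjoint_balls xi xi'; apply: codeword_in.
Qed.

(** The ball about codeword number [k] is disjoint from the [k] balls in use and spans by itself. *)
Lemma affine_zero_spare_codeword : (k < #|code|)%N ->
  affine_zero_on (fun x => forall i, ~~ ball (codeword i) x).
Proof.
move=> ltk a b van; pose c := nth [ffun=> false] (enum code) k.
have cc : c \in code by rewrite -mem_enum mem_nth // -cardE.
apply: (affine_zero_on_ball (y := c)) => x xc; apply: van => i; apply/negP => xi.
have /eqP := disjoint_balls cc (codeword_in i (ltnW ltk)) xc xi.
rewrite nth_uniq ?enum_uniq -?cardE ?(ltn_trans (ltn_ord _)) //.
by rewrite gtn_eqF.
Qed.

(* The characters (-1)^(x i) are orthogonal on the coset [synd x = t]. *)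
Lemma affine_zero_coset t x0 : (1 < n)%N -> (k <= #|code|)%N ->
  t != 0 -> (forall j, col j != t) -> synd x0 = t ->
  (forall i j, i != j -> exists y, [/\ synd y = 0, y i & ~~ y j]) ->
  affine_zero_on (fun x => forall i, ~~ ball (codeword i) x).
Proof.
move=> n1 lek t0 tcol x0t sep a b van.
(* Points of a ball have syndrome zero or a column, so the coset of syndrome [t] avoids all of
   them. *)
have vanish x : synd x = t -> a + \sum_j (x j)%:R * b j = 0.
  move=> xt; apply: van => i; apply/negP => /(synd_ball (codeword_in i lek)).
  case=> [[xt0 _]|[j [xtj _]]]; first by rewrite -xt xt0 eqxx in t0.
  by have := tcol j; rewrite -xtj xt eqxx.
pose sgn x i : rat := (-1) ^+ x i.
(* Translation by [y] preserves the coset and [f] but flips the sign, so the sum equals its own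
   opposite. *)
have half (f : cube n -> rat) i y : synd y = 0 -> y i ->
    (forall x, f (xadd x y) = f x) -> \sum_(x | synd x == t) sgn x i * f x = 0.
  move=> y0 yi fy; set s := \sum_(x | _) _.
  suff : s = - s by lra.
  rewrite {1}/s (reindex_inj (can_inj (xaddK y))) -sumrN /=; apply: eq_big => x.
    by rewrite synd_xadd y0 addr0.
  by move=> _; rewrite fy /sgn ffunE yi addbT; case: (x i); rewrite /= ?expr0 ?expr1; lra.
have other i : exists j : 'I_n, i != j.
  have [i0|i0] := eqVneq i (Ordinal (ltnW n1)); last by exists (Ordinal (ltnW n1)).
  by exists (Ordinal n1); rewrite i0.
have b0 i : b i = 0.
  have [j nej] := other i; have [y [y0 yi _]] := sep i j nej.
  have : \sum_(x | synd x == t) sgn x i * (a + \sum_j (x j)%:R * b j) = 0.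
    by apply: big1 => x /eqP xt; rewrite vanish ?mulr0.
  under eq_bigr do rewrite mulrDr big_distrr /=.
  rewrite big_split /= (half (fun=> a) i y) // add0r exchange_big (bigD1 i) //=.
  rewrite [X in _ + X]big1 ?addr0 => [|l nel]; last first.
    rewrite eq_sym in nel.
    have [z [z0 zi zl]] := sep i l nel.
    apply: (half (fun x => (x l)%:R * b l) i z) => // x.
    by rewrite ffunE (negbTE zl) addbF.
  (* Only the term of [b i] survives, multiplied by the number of coset points with [x i] set; [x0]
     or its translate by [y] is one of them. *)
  have -> : \sum_(x | synd x == t) sgn x i * ((x i)%:R * b i) =
      - b i * #|[set x | (synd x == t) && x i]|%:R.
    rewrite -sum1_card natr_sum big_distrr /= [RHS](eq_bigl (fun x =>
      (synd x == t) && x i)); last first.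
      by move=> x; rewrite inE.
    rewrite [RHS]big_mkcondr; apply: eq_bigr => x _.
    by rewrite /sgn; case: (x i); rewrite /= ?expr1; lra.
  move/eqP; rewrite mulf_eq0 oppr_eq0 => /orP[/eqP //|].
  rewrite pnatr_eq0 cards_eq0 => /eqP/setP S0; exfalso.
  have := S0 x0; have := S0 (xadd x0 y); rewrite !inE ffunE synd_xadd x0t y0 addr0 eqxx
    yi.
  by case: (x0 i).
split=> //; have := vanish x0 x0t; rewrite big1 ?addr0 // => j _.
by rewrite b0 mulr0.
Qed.

End LinearCodes.

(** * Exceptional slicings in dimensions 4 and 5 *)

Section SmallCases.

(* For these two shortened Hamming codes, some affine function vanishes outside
   the balls; the slicings below were found by computer search. *)
Definition maj3 a b c := [|| a && b, a && c | b && c].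

Fixpoint atmost1 (s : seq bool) :=
  if s is x :: s' then if x then ~~ has id s' else atmost1 s' else true.

Local Notation o0 := ord0.
Local Notation o1 := (lift ord0 ord0).
Local Notation o2 := (lift ord0 (lift ord0 ord0)).
Local Notation o3 := (lift ord0 (lift ord0 (lift ord0 ord0))).
Local Notation o4 := (lift ord0 (lift ord0 (lift ord0 (lift ord0 ord0)))).

Definition slices42 (i : 'I_2) (x : cube 4) : bool :=
  if i == ord0 then maj3 (x o0) (x o1) (x o2)
  else if x o1 then [&& x o0, x o2 & x o3] else x o3 || x o0 && x o2.

(** Three disjoint Hamming balls, about 00000, 11100 and 11011, and a majority of three
    coordinates. *)
Definition slices54 (i : 'I_4) (x : cube 5) : bool :=
  nth false [:: atmost1 [:: x o0; x o1; x o2; x o3; x o4];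
    atmost1 [:: ~~ x o0; ~~ x o1; ~~ x o2; x o3; x o4];
    atmost1 [:: ~~ x o0; ~~ x o1; x o2; ~~ x o3; ~~ x o4];
    maj3 (x o0) (x o2) (x o3)] i.

Lemma threshold_slices42 i : threshold (slices42 i).
Proof.
case: (unliftP ord0 i) => [j|] ->.
  exists (fun j => nth 0 [:: 2; -4; 2; 4] j), (-3) => x.
  rewrite /affine !big_ord_recl big_ord0 /slices42 /=.
  by case: (x o0); case: (x o1); case: (x o2); case: (x o3).
exists (fun j => nth 0 [:: 2; 2; 2; 0] j), (-3) => x.
rewrite /affine !big_ord_recl big_ord0 /slices42 /=.
by case: (x o0); case: (x o1); case: (x o2); case: (x o3).
Qed.

Lemma col_inj_slices42 (u : slice_index 4 2 -> rat) :
  (forall x, slice_comb slices42 u x = 0) -> forall p, u p = 0.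
Proof.
move=> u0.
pose L o (x0 x1 x2 x3 : bool) := u (o, None) + (x0%:R * u (o, Some o0) +
  (x1%:R * u (o, Some o1) + (x2%:R * u (o, Some o2) + x3%:R * u (o, Some o3)))).
have E x0 x1 x2 x3 : L None x0 x1 x2 x3 + ((maj3 x0 x1 x2)%:R * L (Some o0) x0 x1 x2 x3 +
    (if x1 then [&& x0, x2 & x3] else x3 || x0 && x2)%:R * L (Some o1) x0 x1 x2 x3) = 0.
  rewrite -[RHS](u0 [ffun j : 'I_4 => nth false [:: x0; x1; x2; x3] j]) slice_combE.
  by rewrite !big_ord_recl !big_ord0 /slices42 !ffunE /= !addr0.
(* One equation for each of the 16 vertices, in 15 unknowns. *)
move: (E false false false false) (E false false false true) (E false false true false)
  (E false false true true) (E false true false false) (E false true false true)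
  (E false true true false) (E false true true true) (E true false false false)
  (E true false false true) (E true false true false) (E true false true true)
  (E true true false false) (E true true false true) (E true true true false)
  (E true true true true).
rewrite /L /= !mul1r !mul0r !add0r !addr0 => {E L u0}; do 16!move=> ?.
have ord2 (P : option 'I_2 -> Prop) : P None -> P (Some o0) -> P (Some o1) -> forall o, P
  o.
  move=> ? ? ? [i|] //; case: (unliftP ord0 i) => [j ->|-> //].
  by case: (unliftP ord0 j) => [[]|-> //].
have ord4 (P : option 'I_4 -> Prop) : P None -> P (Some o0) -> P (Some o1) ->
    P (Some o2) -> P (Some o3) -> forall o, P o.
  move=> ? ? ? ? ? [i|] //; case: (unliftP ord0 i) => [j ->|-> //].
  case: (unliftP ord0 j) => [l ->|-> //]; case: (unliftP ord0 l) => [m ->|-> //].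
  by case: (unliftP ord0 m) => [[]|-> //].
by case; elim/ord2; elim/ord4; lra.
Qed.

Lemma threshold_slices54 i : threshold (slices54 i).
Proof.
pose W : seq (seq int) := [:: [:: -2; -2; -2; -2; -2]; [:: 2; 2; 2; -2; -2];
  [:: 2; 2; -2; 2; 2]; [:: 2; 0; 2; 2; 0]].
pose c : seq int := [:: 3; -3; -5; -3].
exists (fun j => nth 0 (nth [::] W i) j), (nth 0 c i) => x.
rewrite /affine !big_ord_recl big_ord0 /slices54 /W /c.
do 4?[case: (unliftP ord0 i) => [{}i|] ->; last first].
all: try by case: (x o0); case: (x o1); case: (x o2); case: (x o3); case: (x o4).
by case: i.
Qed.

(** Solved block by block from six points each: first outside all slices, then in the majority slice
    only, then in each ball. *)
Lemma col_inj_slices54 (u : slice_index 5 4 -> rat) :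
  (forall x, slice_comb slices54 u x = 0) -> forall p, u p = 0.
Proof.
move=> u0.
pose L o (x0 x1 x2 x3 x4 : bool) := u (o, None) + (x0%:R * u (o, Some o0) +
  (x1%:R * u (o, Some o1) + (x2%:R * u (o, Some o2) + (x3%:R * u (o, Some o3) +
   x4%:R * u (o, Some o4))))).
have E x0 x1 x2 x3 x4 : L None x0 x1 x2 x3 x4 +
   ((atmost1 [:: x0; x1; x2; x3; x4])%:R * L (Some o0) x0 x1 x2 x3 x4 +
   ((atmost1 [:: ~~ x0; ~~ x1; ~~ x2; x3; x4])%:R * L (Some o1) x0 x1 x2 x3 x4 +
   ((atmost1 [:: ~~ x0; ~~ x1; x2; ~~ x3; ~~ x4])%:R * L (Some o2) x0 x1 x2 x3 x4 +
    (maj3 x0 x2 x3)%:R * L (Some o3) x0 x1 x2 x3 x4))) = 0.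
  rewrite -[RHS](u0 [ffun j : 'I_5 => nth false [:: x0; x1; x2; x3; x4] j]) slice_combE.
  by rewrite !big_ord_recl !big_ord0 /slices54 !ffunE /= !addr0.
pose zero o := u (o, None) = 0 /\ [/\ u (o, Some o0) = 0, u (o, Some o1) = 0,
  u (o, Some o2) = 0, u (o, Some o3) = 0 & u (o, Some o4) = 0].
have L0 o x0 x1 x2 x3 x4 : zero o -> L o x0 x1 x2 x3 x4 = 0.
  by rewrite /L => -[-> [-> -> -> -> ->]]; rewrite !mulr0 !addr0.
have zN : zero None.
  move: (E false true false true false) (E true false false false true)
    (E false true false false true) (E false false true false true)
    (E false true true false true) (E false false false true true).
  by rewrite /zero /L /= !mul1r !mul0r !add0r !addr0 => *; repeat split; lra.
have z3 : zero (Some o3).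
  move: (E true false false true false) (E false false true true false)
    (E true false true true false) (E false true true true false)
    (E true false true false true) (E false false true true true).
  by rewrite !(L0 None) // /zero /L /= !mul1r !mul0r !add0r !addr0 => *; repeat split;
    lra.
have z0 : zero (Some o0).
  move: (E false false false false false) (E true false false false false)
    (E false true false false false) (E false false true false false)
    (E false false false true false) (E false false false false true).
  by rewrite !(L0 None) // !(L0 (Some o3)) // /zero /L /= !mul1r !mul0r !add0r !addr0 =>
    *; repeat split; lra.
have z1 : zero (Some o1).
  move: (E true true true false false) (E false true true false false)
    (E true false true false false) (E true true false false false)
    (E true true true true false) (E true true true false true).
  by rewrite !(L0 None) // !(L0 (Some o3)) // /zero /L /= !mul1r !mul0r !add0r !addr0 =>
    *; repeat split; lra.
have z2 : zero (Some o2).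
  move: (E true true false true true) (E false true false true true)
    (E true false false true true) (E true true true true true)
    (E true true false false true) (E true true false true false).
  by rewrite !(L0 None) // !(L0 (Some o3)) // /zero /L /= !mul1r !mul0r !add0r !addr0 =>
    *; repeat split; lra.
have zS i : zero (Some i).
  do 4?[case: (unliftP ord0 i) => [{}i|] -> //].
  by case: i.
have z o : zero o by case: o.
case=> o [j|]; last by have [] := z o.
have [_ [? ? ? ? ?]] := z o.
do 5?[case: (unliftP ord0 j) => [{}j|] -> //].
by case: j.
Qed.

End SmallCases.

(** * Parity checks of shortened Hamming codes *)

Section HammingColumns.
Variable r : nat.
Local Notation G := 'rV['F_2]_r.+1.

Lemma rVF2_addgg (g : G) : g + g = 0.
Proof.
by apply/rowP => i; rewrite !mxE; apply/val_inj; case: (g 0 i) => -[|[|]].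
Qed.

Lemma card_rVF2 : #|{: G}| = (2 ^ r.+1)%N.
Proof. by rewrite card_mx mul1n card_Fp. Qed.

Definition off_plane : {set G} := [set g : G | g 0 0 != 0].

Lemma off_planeD g h :
  ((g + h) \in off_plane) = (g \in off_plane) (+) (h \in off_plane).
Proof.
rewrite !inE mxE; move: (g 0 0) (h 0 0) => [[|[|a]] lta] [[|[|b]] ltb] //.
Qed.

(** Translation by a vector off the hyperplane exchanges it with its complement. *)
Lemma card_off_plane : #|off_plane| = (2 ^ r)%N.
Proof.
have e_off : delta_mx 0 0 \in off_plane by rewrite inE mxE.
have tr_inj : injective (fun g : G => g + delta_mx 0 0) by apply: addIr.
have : (#|off_plane| + #|~: off_plane| = 2 * 2 ^ r)%N by rewrite cardsC card_rVF2 expnS.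
suff -> : #|~: off_plane| = #|off_plane| by lia.
rewrite -(card_imset _ tr_inj); apply/eq_card => g; apply/imsetP/idP => [[h hE ->]|gE].
  by rewrite off_planeD e_off addbT; rewrite inE in hE.
exists (g + delta_mx 0 0); last by rewrite -addrA rVF2_addgg addr0.
by rewrite inE off_planeD e_off gE.
Qed.

(* The elements off the hyperplane come first, so that they all are columns
   of the parity check matrix as soon as [2 ^ r <= n]. *)
Definition columns : seq G :=
  enum off_plane ++ enum [set g | (g != 0) && (g \notin off_plane)].

Lemma mem_columns g : (g \in columns) = (g != 0).
Proof.
rewrite mem_cat !mem_enum [in X in _ || X]inE; case: (boolP (g \in off_plane));
  rewrite ?andbT ?andbF ?orbF //.
by move=> gE; apply/esym; apply: contraTneq gE => ->; rewrite inE mxE eqxx.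
Qed.

Lemma uniq_columns : uniq columns.
Proof.
rewrite cat_uniq !enum_uniq andbT /=; apply/hasPn => g.
by rewrite !mem_enum [_ \in [set _ | _]]inE => /andP[].
Qed.

Lemma size_columns : size columns = (2 ^ r.+1).-1.
Proof.
rewrite -(card_uniqP uniq_columns) -card_rVF2 -(cardsC1 (0 : G)).
by apply: eq_card => g; rewrite mem_columns !inE.
Qed.

Variable n : nat.
Definition column (j : 'I_n) : G := nth 0 columns j.

Lemma column_onto g : g != 0 -> ((2 ^ r.+1).-1 <= n)%N -> exists j, column j = g.
Proof.
rewrite -mem_columns -size_columns => gc len.
have lti : (index g columns < n)%N by rewrite (leq_trans _ len) // index_mem.
by exists (Ordinal lti); rewrite /column nth_index.
Qed.

Lemma column_off_plane g : g \in off_plane -> (2 ^ r <= n)%N -> exists j, column j = g.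
Proof.
rewrite -mem_enum -card_off_plane cardE => gE len.
have lti : (index g (enum off_plane) < n)%N by rewrite (leq_trans _ len) // index_mem.
by exists (Ordinal lti); rewrite /column nth_cat index_mem gE nth_index.
Qed.

Hypothesis lenc : (n < 2 ^ r.+1)%N.

Lemma ltn_columns (j : 'I_n) : (j < size columns)%N.
Proof. by rewrite size_columns (leq_trans (ltn_ord j)) // -ltnS prednK // expn_gt0. Qed.

Lemma column_neq0 j : column j != 0.
Proof. by rewrite -mem_columns mem_nth ?ltn_columns. Qed.

Lemma column_inj : injective column.
Proof.
by move=> i j /eqP; rewrite nth_uniq ?uniq_columns ?ltn_columns // => /eqP/val_inj.
Qed.

Lemma missing_column : (n.+1 < 2 ^ r.+1)%N -> exists2 t : G, t != 0 & forall j, column j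
  != t.
Proof.
move=> ltn1; have ltn2 : (n < size columns)%N.
  by rewrite size_columns -ltnS prednK // expn_gt0.
exists (nth 0 columns n) => [|j]; first by rewrite -mem_columns mem_nth.
by rewrite nth_uniq ?uniq_columns ?ltn_columns // ltn_eqF.
Qed.

Local Notation synd := (synd column).

Lemma pick_off_plane (s : seq G) : (size s < 2 ^ r)%N ->
  exists2 g, g \in off_plane & g \notin s.
Proof.
move=> lts; have [|] := boolP [exists g, (g \in off_plane) && (g \notin s)].
  by move=> /existsP[g /andP[]]; exists g.
rewrite negb_exists => /forallP sub; move: lts; rewrite ltnNge -card_off_plane.
suff -> : (#|off_plane| <= size s)%N by [].
apply: leq_trans (card_size s); apply/subset_leq_card/subsetP => g gE.
by have := sub g; rewrite gE negbK.
Qed.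

(* Relations of three or four columns inside the complement of a hyperplane. *)
Lemma separating_codeword i j : (2 < r)%N -> (2 ^ r <= n)%N -> i != j ->
  exists y : cube n, [/\ synd y = 0, y i & ~~ y j].
Proof.
move=> r2 len neij; have r8 : (4 < 2 ^ r)%N by rewrite (@ltn_exp2l 2 2).
have neij' : column i != column j by rewrite (inj_eq column_inj).
have synd0 (y z : cube n) : synd y = synd z -> synd (xadd y z) = 0.
  by move=> yz; rewrite (synd_xadd _ rVF2_addgg) yz rVF2_addgg.
have [iE|iE] := boolP (column i \in off_plane).
  have [a aE] := @pick_off_plane [:: column i; column j] (ltnW (ltnW r8)).
  rewrite !inE !negb_or => /andP[nai naj].
  (* In the relation with columns [i], [a], [b] and [c], excluding [a] for [b] gives
     [c != column i], and excluding the last vector gives [c != column j]. Four exclusions are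
     possible since [2 ^ r > 4]. *)
  have [b bE] := @pick_off_plane [:: column i; column j; a; column i + a + column j] r8.
  rewrite !inE !negb_or => /and4P[nbi nbj nba nbc].
  pose c := column i + a + b.
  have cE : c \in off_plane by rewrite !off_planeD iE aE bE.
  have [ja jaE] := column_off_plane aE len; have [jb jbE] := column_off_plane bE len.
  have [jc jcE] := column_off_plane cE len.
  have nci : c != column i.
    rewrite /c -addrA -subr_eq0 addrAC subrr add0r addr_eq0 (oppg rVF2_addgg).
    by rewrite eq_sym.
  have ncj : c != column j.
    by apply: contra nbc => /eqP <-; rewrite /c addrA rVF2_addgg add0r.
  exists (xadd (xadd (unit_vec i) (unit_vec ja)) (xadd (unit_vec jb) (unit_vec jc)));
    split.
  - apply: synd0; rewrite !(synd_xadd _ rVF2_addgg) !synd_unit_vec jaE jbE jcE /c.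
    by rewrite [b + _]addrC -addrA rVF2_addgg addr0.
  - rewrite !ffunE -!(inj_eq column_inj) jaE jbE jcE eqxx.
    by rewrite eq_sym (negbTE nai) eq_sym (negbTE nbi) eq_sym (negbTE nci).
  rewrite !ffunE -!(inj_eq column_inj) jaE jbE jcE eq_sym (negbTE neij').
  by rewrite eq_sym (negbTE naj) eq_sym (negbTE nbj) eq_sym (negbTE ncj).
(* With column [i] in the hyperplane, three columns suffice; the two exclusions keep [a] and [b]
   away from column [j]. *)
have [a aE] := @pick_off_plane [:: column j; column i + column j] (ltnW (ltnW r8)).
rewrite !inE !negb_or => /andP[naj nac].
pose b := column i + a; have bE : b \in off_plane by rewrite off_planeD (negbTE iE) aE.
have [ja jaE] := column_off_plane aE len; have [jb jbE] := column_off_plane bE len.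
have nai : a != column i by apply: contraNneq iE => <-.
have nbi : b != column i by apply: contraNneq iE => <-.
have nbj : b != column j.
  apply: contra nac => /eqP <-; by rewrite /b addrA rVF2_addgg add0r.
exists (xadd (unit_vec i) (xadd (unit_vec ja) (unit_vec jb))); split.
- apply: synd0; rewrite !(synd_xadd _ rVF2_addgg) !synd_unit_vec jaE jbE /b.
  by rewrite addrCA rVF2_addgg addr0.
- rewrite !ffunE -!(inj_eq column_inj) jaE jbE eqxx.
  by rewrite eq_sym (negbTE nai) eq_sym (negbTE nbi).
rewrite !ffunE -!(inj_eq column_inj) jaE jbE eq_sym (negbTE neij').
by rewrite eq_sym (negbTE naj) eq_sym (negbTE nbj).
Qed.

(** A vector of the hyperplane is the sum of two vectors off it, and those are all columns. *)
Lemma synd_onto t : (2 ^ r <= n)%N -> t \notin off_plane -> exists x : cube n, synd x = t.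
Proof.
move=> len tE; have e_off : delta_mx 0 0 \in off_plane by rewrite inE mxE.
have eE : t + delta_mx 0 0 \in off_plane by rewrite off_planeD (negbTE tE) e_off.
have [ja jaE] := column_off_plane e_off len; have [jb jbE] := column_off_plane eE len.
exists (xadd (unit_vec ja) (unit_vec jb)).
rewrite (synd_xadd _ rVF2_addgg) !synd_unit_vec jaE jbE.
by rewrite addrCA rVF2_addgg addr0.
Qed.

(** The set of columns of [S] and its translate by [g] both avoid 0 and [g], so by counting they
    meet. *)
Lemma pigeonhole_columns (S : {set 'I_n}) g : g != 0 -> (forall j, j \in S -> column j !=
  g) ->
  (2 ^ r.+1 < 2 * #|S| + 2)%N -> exists a b, [/\ a \in S, b \in S & column a + column b =
    g].
Proof.
move=> g0 gS big; pose A := column @: S; pose B := [set g + h | h in A].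
have cardA : #|A| = #|S| by apply/card_imset/column_inj.
have cardB : #|B| = #|S| by rewrite -cardA; apply/card_imset/addrI.
have AB_sub : A :|: B \subset ~: [set 0; g].
  apply/subsetP => h; rewrite !inE => /orP[/imsetP[a aS ->]|/imsetP[_ /imsetP[a aS ->]
    ->]].
    by rewrite negb_or column_neq0 gS.
  rewrite negb_or addr_eq0 (oppg rVF2_addgg) eq_sym gS //=.
  by rewrite -subr_eq0 addrAC subrr add0r column_neq0.
have [AB0|[h]] := set_0Vmem (A :&: B); last first.
  rewrite inE => /andP[/imsetP[a aS ->] /imsetP[_ /imsetP[b bS ->] ab]].
  by exists a, b; rewrite ab -addrA rVF2_addgg addr0.
have := subset_leq_card AB_sub; have := cardsC [set 0; g]; have := cardsUI A B.
rewrite AB0 cards0 cardA cardB card_rVF2 cards2 eq_sym g0 addn0 => -> /=.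
by move: big; move: (2 ^ _)%N #|S| #|~: _| => a b c ? ? ?; exfalso; lia.
Qed.

End HammingColumns.

(** * Good slicings in both ranges of [k] *)

Definition col_injective n k (H : 'I_k -> cube n -> bool) :=
  forall u : slice_index n k -> rat, (forall x, slice_comb H u x = 0) -> forall p, u p =
    0.

Definition row_surjective n k (H : 'I_k -> cube n -> bool) :=
  forall y, exists u : slice_index n k -> rat, forall x, slice_comb H u x = (x == y)%:R.

Definition has_good_slicing n k := exists H : 'I_k -> cube n -> bool,
  (forall i, threshold (H i)) /\ (col_injective H \/ row_surjective H).

(** Here all nonzero syndromes occur as columns, so the balls about codewords cover the cube.
    Coordinates beyond the list get the zero column, which a covering tolerates. *)
Lemma good_slicing_cover n k : (0 < n)%N -> (2 ^ (n - trunc_log 2 n.+1) <= k)%N ->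
  has_good_slicing n k.
Proof.
move=> n0 lek; have /andP[lo hi] := trunc_log_bounds (ltnSn 1) (ltn0Sn n).
have s0 : (0 < trunc_log 2 n.+1)%N by rewrite trunc_log_gt0.
move: lo lek; rewrite -(prednK s0); set r := (trunc_log 2 n.+1).-1 => lo lek.
have cover g : g != 0 -> exists j : 'I_n, column r j = g.
  by move=> g0; apply: column_onto; rewrite // -ltnS prednK // expn_gt0.
exists (fun i => ball (codeword (@column r n) i)); split=> [i|];
  first exact: threshold_ball.
right; apply: row_surj_Hamming => //; first exact: rVF2_addgg.
apply: leq_trans lek; have := card_code_le (@rVF2_addgg r) cover.
rewrite card_rVF2 => le_code.
have ler : (r.+1 <= n)%N.
  by rewrite -(leq_exp2l _ _ (ltnSn 1)) (leq_trans lo) // ltn_expl.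
by rewrite -(leq_pmul2l (m := 2 ^ r.+1)) ?expn_gt0 // -expnD subnKC.
Qed.

Lemma good_slicing_coset n k r (t : 'rV['F_2]_r.+1) (x0 : cube n) :
  (1 < n)%N -> (n < 2 ^ r.+1)%N -> (k <= #|code (@column r n)|)%N ->
  t != 0 -> (forall j : 'I_n, column r j != t) -> synd (@column r n) x0 = t ->
  (forall i j : 'I_n, i != j -> exists y, [/\ synd (@column r n) y = 0, y i & ~~ y j]) ->
  has_good_slicing n k.
Proof.
move=> n1 ltn lek t0 tcol x0t sep.
exists (fun i => ball (codeword (@column r n) i)); split=> [i|];
  first exact: threshold_ball.
have addgg := @rVF2_addgg r; have inj := column_inj ltn; have neq0 := column_neq0 ltn.
left => u u0; apply: (col_inj_Hamming addgg inj neq0 lek _ u0).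
exact: (affine_zero_coset addgg n1 lek t0 tcol x0t sep).
Qed.

(** There may be no spare codeword, but some nonzero vector [t] is not a column; its coset lies
    outside all balls and spans except in low dimensions. *)
Lemma good_slicing_gap n k r : (2 ^ r < n.+1)%N -> (n.+1 < 2 ^ r.+1)%N ->
  (k <= #|code (@column r n)|)%N -> k = (2 ^ (n - r.+1))%N -> has_good_slicing n k.
Proof.
move=> lo hi lek kE; have ltn := ltnW hi.
have [r3|r3] := ltnP 2 r.
  have [t t0 tcol] := missing_column ltn hi.
  have tE : t \notin off_plane r.
    by apply/negP => /column_off_plane/(_ lo)[j jt]; have := tcol j; rewrite jt eqxx.
  have [x0 x0t] := synd_onto lo tE.
  apply: (good_slicing_coset _ ltn lek t0 tcol x0t) => [|i j];
    last exact: separating_codeword.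
  by rewrite -ltnS (leq_trans _ lo) // ltnS (@leq_exp2l 2 1) // ltnW // ltnW.
case: r r3 lo hi lek kE ltn => [|[|[|//]]] _ lo hi lek kE ltn; first by move: lo hi; lia.
  (* In dimension 2 the only ball misses a single vertex, which [row_surj_balls] permits. *)
  have n2 : n = 2%N by move: lo hi; lia.
  move: kE; rewrite n2 /= => ->; clear.
  exists (fun _ => ball [ffun=> false]); split=> [i|]; first exact: threshold_ball.
  right; apply: (row_surj_balls (z := [ffun=> true])) => x xz; exists ord0.
  rewrite /ball !big_ord_recl big_ord0 !ffunE.
  case x0: (x ord0); case x1: (x (lift ord0 ord0)) => //.
  case/negP: xz; apply/eqP/ffunP => i; rewrite ffunE.
  by do 2?[case: (unliftP ord0 i) => [{}i|] -> //]; case: i.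
have : [|| n == 4, n == 5 | n == 6]%N by move: lo hi; lia.
case/or3P => /eqP nE; move: kE lek ltn hi; rewrite nE /= => kE lek ltn hi.
- rewrite kE; exists slices42; split; first exact: threshold_slices42.
  by left; apply: col_inj_slices42.
- rewrite kE; exists slices54; split; first exact: threshold_slices54.
  by left; apply: col_inj_slices54.
(* In length 6 pigeonhole replaces the hyperplane argument: it writes [t] as a sum of two columns,
   and column [i] as a sum of two of the four columns other than [i] and [j]. *)
have [t t0 tcol] := missing_column ltn hi; have addgg := @rVF2_addgg 2.
have [a [b [_ _ abt]]] : exists a b, [/\ a \in [set: 'I_6], b \in [set: 'I_6] &
    column 2 a + column 2 b = t].
  by apply: pigeonhole_columns => //; rewrite cardsT card_ord.
apply: (good_slicing_coset (x0 := xadd (unit_vec a) (unit_vec b)) _ ltn lek t0 tcol) =>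
  //.
  by rewrite (synd_xadd _ addgg) !synd_unit_vec.
move=> i j neij.
have [c [e [cS eS cei]]] : exists c e, [/\ c \in ~: [set i; j], e \in ~: [set i; j] &
    column 2 c + column 2 e = column 2 i].
  apply: pigeonhole_columns => //; first exact: column_neq0.
    by move=> l; rewrite !inE negb_or (inj_eq (column_inj ltn)) => /andP[].
  by have := cardsC [set i; j]; rewrite cards2 neij card_ord; move: #|~: _| => m; lia.
exists (xadd (unit_vec i) (xadd (unit_vec c) (unit_vec e))); split.
- by rewrite !(synd_xadd _ addgg) !synd_unit_vec cei addgg.
- rewrite !ffunE eqxx; move: cS eS; rewrite !inE !negb_or.
  by rewrite ![_ == i]eq_sym => /andP[/negbTE -> _] /andP[/negbTE -> _].
rewrite !ffunE; move: cS eS; rewrite !inE !negb_or [j == i]eq_sym (negbTE neij).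
by rewrite ![_ == j]eq_sym => /andP[_ /negbTE ->] /andP[_ /negbTE ->].
Qed.

(** If a codeword is spare, its ball spans. Otherwise [k] is the size of the code, and either
    [n + 1] lies below the power of two and the gap case applies, or the code is perfect and its
    balls cover the cube. *)
Lemma good_slicing_pack n k : (0 < n)%N -> (k <= 2 ^ (n - up_log 2 n.+1))%N ->
  has_good_slicing n k.
Proof.
move=> n0 lek; have /andP[lo hi] := up_log_bounds (ltnSn 1) (n0 : (1 < n.+1)%N).
have s0 : (0 < up_log 2 n.+1)%N by rewrite up_log_gt0.
move: lo hi lek; rewrite -(prednK s0) /=; set r := (up_log 2 n.+1).-1 => lo hi lek.
have ltrn : (r < n)%N by rewrite -(ltn_exp2l _ _ (ltnSn 1)) (leq_ltn_trans _ (ltn_expl n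
  (ltnSn 1))).
have code_ge : (2 ^ (n - r.+1) <= #|code (@column r n)|)%N.
  have := card_code_ge (@column r n) (@rVF2_addgg r); rewrite card_rVF2.
  by rewrite -{1}(subnKC ltrn) expnD leq_pmul2l ?expn_gt0.
have [ltk|gek] := ltnP k #|code (@column r n)|.
  exists (fun i => ball (codeword (@column r n) i)); split=> [i|];
    first exact: threshold_ball.
  left => u u0; apply: (col_inj_Hamming _ _ _ _ _ u0); first exact: rVF2_addgg.
  - exact: column_inj.
  - exact: column_neq0.
  - exact: ltnW.
  by apply: affine_zero_spare_codeword => //; [exact: rVF2_addgg|exact: column_inj|exact:
    column_neq0].
have kE : k = (2 ^ (n - r.+1))%N by apply/eqP; rewrite eqn_leq lek (leq_trans code_ge).
have kC : k = #|code (@column r n)|.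
  by apply/eqP; rewrite eqn_leq gek andbT (leq_trans lek).
have [hi1|hi1|hi1] := ltngtP n.+1 (2 ^ r.+1).
- exact: (good_slicing_gap lo hi1 (eq_leq kC) kE).
- by rewrite leqNgt hi1 in hi.
exists (fun i => ball (codeword (@column r n) i)); split=> [i|];
  first exact: threshold_ball.
right; apply: row_surj_Hamming => //; first exact: rVF2_addgg.
by move=> g g0; apply: column_onto; rewrite // -hi1.
Qed.

Theorem theorem1p2 (R : realType) (n k : nat) :
  (1 <= n)%N -> (1 <= k)%N ->
  ((k <= 2 ^ (n - up_log 2 n.+1))%N \/ (2 ^ (n - trunc_log 2 n.+1) <= k)%N) ->
  semialgebraic (@RBM_model R n k) /\
  semialg_dim (@RBM_model R n k) (minn (n * k + n + k) (2 ^ n - 1)).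
Proof.
move=> n0 _ hk; split; first exact: semialgebraic_RBM.
have [H [thH good]] : has_good_slicing n k.
  by case: hk => hk; [apply: good_slicing_pack|apply: good_slicing_cover].
have no_sum1 := @no_chain_sum1 R _ _ (@RBM_model_sum1 R n k).
(* Independent columns make the parameter count the smaller bound, independent rows the dimension of
   the simplex. *)
case: good => [inj|surj].
  have [chain lt] := prime_chain_of_col_inj R n0 thH inj.
  rewrite subn1 (minn_idPl _); first by split=> //; apply: no_chain_param.
  by rewrite -ltnS prednK // expn_gt0.
have [chain le] := prime_chain_of_row_surj R n0 thH surj.
by rewrite subn1 (minn_idPr le).
Qed.
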